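(* Let $0<\kappa<1/(32d)$. Then there exists at most one stationary measure in $\mathscr P_1(\mathbb R^{|\Lambda|})$ for the mean-field SDE (MF) with $\mathfrak A=\Lambda$, and there exists at most one stationary measure in $\mathscr P_1(\mathbb H)$ for the mean-field SDE (MF) with $\mathfrak A=\mathbb Z^d$.
   Context: Fix $d\ge1$, $a>1$. $\Lambda$ is the discrete torus $\mathbb Z^d\cap L\,\mathbb T^d$ of side length $L$ with unit spacing; $x\sim y$ means nearest neighbours; $|x|$ for $x\in\mathbb Z^d$ is the graph distance to $0$. $\mathbb H=\ell^2_a=\{v:\mathbb Z^d\to\mathbb R:\ \|v\|_2^2:=\sum_xa^{-|x|}|v_x|^2<\infty\}$. Put $E=\mathbb R^{|\Lambda|}$ if $\mathfrak A=\Lambda$ and $E=\mathbb H$ if $\mathfrak A=\mathbb Z^d$. (MF): for $x\in\mathfrak A$, $t\geq 0$, $$\mathrm d\Psi_x=2\kappa\sum_{y\sim x}\big(\Psi_y-\mathbb E[\Psi_x\Psi_y]\Psi_x\big)\mathrm dt-\tfrac12\Psi_x\,\mathrm dt+\mathrm dW_x,\qquad \Psi_x(0)=\psi_x,$$ with independent standard Brownian motions $W_x$, considered on $[0,T]$ with $T>0$ arbitrary. Martingale solutions: let $\mathbb S=C([0,T];E)$, $\pi_t(w)=w_t$, $\mathscr F_t=\sigma(\pi_s:s\le t)$, $\mathbf D_x(v,\nu)=2\kappa\sum_{y\sim x}v_y-2\kappa\sum_{y\sim x}\int u_xu_y\,\nu(\mathrm du)\,v_x-\tfrac12v_x$. $\mathbf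 P\in\mathscr P(\mathbb S)$ is a martingale solution with initial distribution $\mu_0$ if, with $\mu_s=\mathbf P\circ\pi_s^{-1}$: (i) $\mathbf P\circ\pi_0^{-1}=\mu_0$ and $\int_0^T\|\mathbf D(w_s,\mu_s)\|_E\mathrm ds<\infty$ $\mathbf P$-a.s.; (ii) for every $\theta\in\mathbb R^{|\Lambda|}$ (resp. every finitely supported $\theta:\mathbb Z^d\to\mathbb R$), $\langle w_t,\theta\rangle-\langle w_0,\theta\rangle-\int_0^t\langle\mathbf D(w_s,\mu_s),\theta\rangle\mathrm ds$ is a continuous square-integrable $(\mathscr F_t)$-martingale under $\mathbf P$ with quadratic variation $t\sum_x\theta_x^2$, where $\langle v,\theta\rangle=\sum_xv_x\theta_x$. A probability measure $\mu$ on $E$ is a stationary measure for (MF) if there is a martingale solution $\mathbf P$ with initial distribution $\mu$ and $\mathbf P\circ\pi_t^{-1}=\mu$ for all $0\le t\le T$ (the paper's argument uses this for every $T>0$). $\mathscr P_1(E)$ is the set of $\mu\in\mathscr P(E)$ with $\int|v_x|^2\,\mathrm d\mu(v)\le1$ for all $x\in\mathfrak A$. *)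

(* Defs.v *)
From HB Require Import structures.
From mathcomp Require Import all_boot all_order all_algebra.
From mathcomp Require Import all_classical all_reals all_analysis.
From mathcomp Require Import ring lra zify.

Set Implicit Arguments.
Unset Strict Implicit.
Unset Printing Implicit Defensive.

Import Order.TTheory GRing.Theory Num.Theory.
Import numFieldNormedType.Exports.

Local Open Scope classical_set_scope.
Local Open Scope ring_scope.

(* The space ell^2 over I with positive weight c, normed by
   |v|^2 = sum_x c_x v_x^2.  For finite I it contains every v : I -> R
   (finite_norm2_fin), so that unit weights give the Euclidean space R^I.
   enorm is the norm of an arbitrary v : I -> R, infinite off ell2 c. *)
Section weighted_norm.
Variables (R : realType) (I : choiceType) (c : I -> {posnum R}).
Implicit Types u v : I -> R.

Definition enorm2 v : \bar R := \esum_(x in [set: I]) ((c x)%:num * v x ^+ 2)%:E.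

Lemma enorm2_term_ge0 v x : (0 <= ((c x)%:num * v x ^+ 2)%:E)%E.
Proof. by rewrite lee_fin mulr_ge0// sqr_ge0. Qed.

Lemma enorm2_ge0 v : (0 <= enorm2 v)%E.
Proof. by apply: esum_ge0 => x _; exact: enorm2_term_ge0. Qed.

Lemma enorm20 : enorm2 0 = 0%E.
Proof. by apply: esum1 => x _; rewrite (_ : (0 : I -> R) x = 0)// expr0n mulr0. Qed.

Lemma le_enorm2Z k v : (enorm2 (k *: v) <= (k ^+ 2)%:E * enorm2 v)%E.
Proof.
have k0 : (0 <= (k ^+ 2)%:E)%E by rewrite lee_fin sqr_ge0.
apply: ge_ereal_sup => _ [X [finX XI]] <-.
under eq_fsbigr => x _ do rewrite (_ : (k *: v) x = k * v x)// exprMn mulrCA EFinM.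
rewrite -ge0_mule_fsumr; last by move=> x; exact: enorm2_term_ge0.
by apply: lee_wpmul2l => //; apply: ereal_sup_ubound; exists X.
Qed.

Lemma le_enorm2D (e : R) u v : 0 < e ->
  (enorm2 (u + v)%R <= (1 + e)%:E * enorm2 u + (1 + e^-1)%:E * enorm2 v)%E.
Proof.
move=> e0; have ei0 : 0 < e^-1 by rewrite invr_gt0.
have e1 : (0 <= (1 + e)%:E)%E by rewrite lee_fin addr_ge0// ltW.
have e2 : (0 <= (1 + e^-1)%:E)%E by rewrite lee_fin addr_ge0// ltW.
apply: ge_ereal_sup => _ [X [finX XI]] <-.
have : (\sum_(x \in X) ((c x)%:num * (u + v) x ^+ 2)%:E <=
  \sum_(x \in X) ((1 + e)%:E * ((c x)%:num * u x ^+ 2)%:E +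
                  (1 + e^-1)%:E * ((c x)%:num * v x ^+ 2)%:E))%E.
  apply: lee_fsum => // x _.
  rewrite -!EFinM -EFinD lee_fin.
  rewrite [leRHS](_ : _ = (c x)%:num *
    ((1 + e) * u x ^+ 2 + (1 + e^-1) * v x ^+ 2)); last by ring.
  rewrite ler_wpM2l// (_ : (u + v) x = u x + v x)//.
  suff : 0 <= (e * u x - v x) ^+ 2 * e^-1.
    have -> : (e * u x - v x) ^+ 2 * e^-1 =
      (e * u x ^+ 2 + e^-1 * v x ^+ 2) - 2 * (u x * v x).
      by field; rewrite gt_eqF.
    by nra.
  by rewrite mulr_ge0// ?sqr_ge0// ltW.
move=> /le_trans; apply.
rewrite fsbig_split//=.
rewrite -!ge0_mule_fsumr; try by move=> x; exact: enorm2_term_ge0.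
by apply: leeD; apply: lee_wpmul2l => //; apply: ereal_sup_ubound; exists X.
Qed.

Definition finite_norm2 : {pred (I -> R)} := [pred v | `[< (enorm2 v < +oo)%E >]].

Lemma finite_norm2_submod : submod_closed finite_norm2.
Proof.
split=> [|k u v]; first by apply/asboolP; rewrite enorm20.
move=> /asboolP uoo /asboolP voo; apply/asboolP.
apply: (le_lt_trans (le_enorm2D (k *: u) v ltr01)).
rewrite lte_add_pinfty// lte_mul_pinfty//.
by rewrite (le_lt_trans (le_enorm2Z k u))// lte_mul_pinfty// lee_fin sqr_ge0.
Qed.

HB.instance Definition _ :=
  GRing.isSubmodClosed.Build R (I -> R) finite_norm2 finite_norm2_submod.

Record ell2 := Ell2 { ell2_fun :> I -> R; ell2P : ell2_fun \in finite_norm2 }.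

HB.instance Definition _ := [isSub for ell2_fun].
HB.instance Definition _ := [Choice of ell2 by <:].
HB.instance Definition _ := [SubChoice_isSubLmodule of ell2 by <:].

Definition enorm v : \bar R := sqrte (enorm2 v).

Definition ell2_norm (v : ell2) : R := fine (enorm v).

Lemma ell2_fin (v : ell2) : enorm2 v \is a fin_num.
Proof. by rewrite ge0_fin_numE ?enorm2_ge0//; have /asboolP := ell2P v. Qed.

Lemma ell2_normE (v : ell2) : ell2_norm v = Num.sqrt (fine (enorm2 v)).
Proof. by rewrite /ell2_norm /enorm; case: (enorm2 v) (ell2_fin v). Qed.

Lemma ell2_norm_ge0 (v : ell2) : 0 <= ell2_norm v.
Proof. by rewrite ell2_normE sqrtr_ge0. Qed.

Lemma ell2_norm_sqr (v : ell2) : (ell2_norm v ^+ 2)%:E = enorm2 v.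
Proof.
by rewrite ell2_normE sqr_sqrtr ?fine_ge0 ?enorm2_ge0// fineK// ell2_fin.
Qed.

Lemma ell2_norm_eq0 (v : ell2) : ell2_norm v = 0 -> v = 0.
Proof.
move=> v0; apply/val_inj/funext => x /=.
have : (((c x)%:num * v x ^+ 2)%:E <= enorm2 v)%E.
  rewrite -[leLHS](@esum_set1 _ _ x (fun x => ((c x)%:num * v x ^+ 2)%:E)).
    rewrite /enorm2 [leRHS](esumID [set x])//; last first.
      by move=> *; exact: enorm2_term_ge0.
    rewrite setTI leeDl// esum_ge0// => *; exact: enorm2_term_ge0.
  exact: enorm2_term_ge0.
rewrite -ell2_norm_sqr v0 expr0n/= lee_fin pmulr_rle0// => vx.
by apply/eqP; rewrite -sqrf_eq0 eq_le vx sqr_ge0.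
Qed.

Lemma ell2_normZ k (v : ell2) : ell2_norm (k *: v) = `|k| * ell2_norm v.
Proof.
have le h (w : ell2) : ell2_norm (h *: w) <= `|h| * ell2_norm w.
  rewrite -ler_sqr ?nnegrE ?mulr_ge0 ?ell2_norm_ge0// -lee_fin ell2_norm_sqr.
  by rewrite exprMn real_normK ?num_real// EFinM ell2_norm_sqr le_enorm2Z.
apply/eqP; rewrite eq_le le/=; have [->|k0] := eqVneq k 0.
  by rewrite normr0 mul0r ell2_norm_ge0.
rewrite -ler_pdivlMl ?normr_gt0// -normfV.
by have := le k^-1 (k *: v); rewrite scalerA mulVf// scale1r.
Qed.

Lemma ell2_normD (u v : ell2) : ell2_norm (u + v) <= ell2_norm u + ell2_norm v.
Proof.
have [/ell2_norm_eq0 ->|u0] := eqVneq (ell2_norm u) 0.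
  by rewrite add0r lerDr ell2_norm_ge0.
have [/ell2_norm_eq0 ->|v0] := eqVneq (ell2_norm v) 0.
  by rewrite addr0 lerDl ell2_norm_ge0.
have up : 0 < ell2_norm u by rewrite lt_neqAle eq_sym u0 ell2_norm_ge0.
have vp : 0 < ell2_norm v by rewrite lt_neqAle eq_sym v0 ell2_norm_ge0.
rewrite -ler_sqr ?nnegrE ?addr_ge0 ?ell2_norm_ge0// -lee_fin ell2_norm_sqr.
have /(le_enorm2D u v)/le_trans := divr_gt0 vp up; apply.
rewrite -!ell2_norm_sqr -!EFinM -EFinD lee_fin le_eqVlt; apply/orP; left.
by apply/eqP; field; rewrite u0 v0.
Qed.

HB.instance Definition _ :=
  @Lmodule_isNormed.Build R ell2 ell2_norm ell2_normD ell2_normZ ell2_norm_eq0.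

End weighted_norm.

(* T with its Borel sigma-algebra *)
Notation borel T := (g_sigma_algebraType (@open T)).

Section path_space.
Variables (R : realType) (E : normedModType R) (T : R).

Local Notation time := (`[0, T]%classic : Type).

(* C([0, T]; E) with the topology of uniform convergence. *)
Definition path_space : Type :=
  initial_topology (id : continuousType time E -> {uniform time -> E}).

HB.instance Definition _ := Uniform.on path_space.
HB.instance Definition _ :=
  isPointed.Build path_space (mkcts (@cst_continuous time E (0 : E))).

Definition path_fun (w : path_space) : time -> E := (w : continuousType time E).

(* The coordinate map pi_s, extended by 0 to times s outside [0, T] so that
   paths can be integrated against the Lebesgue measure of R. *)
Definition eval_path (s : R) (w : borel path_space) : borel E :=
  oapp (path_fun w) 0 (insub s).

Lemma eval_pathE (w : path_space) (t : time) : eval_path (\val t) w = path_fun w t.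
Proof. by rewrite /eval_path valK. Qed.

Lemma eval_path_continuous s : continuous (eval_path s : path_space -> E).
Proof.
rewrite /eval_path; case: insubP => [t _ _|_] /=; last exact: cst_continuous.
pose f : path_space -> {uniform time -> E} := path_fun.
have cf : continuous f by exact: initial_continuous.
have ct : continuous (fun h : {uniform time -> E} => h t).
  move=> h A; rewrite -nbhs_entourageE => -[B entB BA].
  apply/uniform_nbhs; exists B; split=> // g hg.
  by apply: BA; apply/xsectionP; exact: hg.
by move=> w; apply: (@continuous_comp _ _ _ f (fun h => h t)); [exact: cf|exact: ct].
Qed.

Lemma measurable_eval_path s : measurable_fun [set: borel path_space] (eval_path s).
Proof.
move=> mT; move: (mT); apply: (@measurability _ _ (borel path_space) (borel E) setT (eval_path s) (@open E)).
  by [].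
move=> _ [U oU <-].
rewrite setTI; apply: sub_sigma_algebra.
by move/continuousP : (@eval_path_continuous s); exact.
Qed.

HB.instance Definition _ s :=
  isMeasurableFun.Build _ _ _ _ (eval_path s) (@measurable_eval_path s).

End path_space.

(* Measures are functions on all sets, meaningful on the measurable ones only,
   so that laws are not compared with Leibniz equality. *)
Definition same_law d (S : measurableType d) (R : realType)
    (mu nu : probability S R) : Prop :=
  forall B, measurable B -> mu B = nu B.

Section martingale.
Context d (Omega : measurableType d) (R : realType).
Variables (P : probability Omega R) (T : R) (F : R -> set (set Omega)).

Definition adapted (M : R -> Omega -> R) : Prop :=
  forall t, t \in `[0, T] -> forall B, measurable B -> F t (M t @^-1` B).

Definition as_continuous (M : R -> Omega -> R) : Prop :=
  {ae P, forall w, {within `[0, T], continuous (M ^~ w)}}.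

Definition martingale (M : R -> Omega -> R) : Prop :=
  [/\ adapted M,
      forall t, t \in `[0, T] -> P.-integrable [set: Omega] (EFin \o M t) &
      forall s t, 0 <= s -> s <= t -> t <= T -> forall A, F s A ->
        (\int[P]_(w in A) (M s w)%:E = \int[P]_(w in A) (M t w)%:E)%E].

Definition square_integrable (M : R -> Omega -> R) : Prop :=
  forall t, t \in `[0, T] -> (\int[P]_w ((M t w) ^+ 2)%:E < +oo)%E.

(* <M> = A for a continuous square-integrable martingale M: A is continuous,
   adapted, nondecreasing, null at 0, and M^2 - A is a martingale. *)
Definition quadratic_variation (M A : R -> Omega -> R) : Prop :=
  [/\ forall w, A 0 w = 0, adapted A, as_continuous A,
      {ae P, forall w, {in `[0, T] &, nondecreasing (A ^~ w)}} &
      martingale (fun t w => (M t w) ^+ 2 - A t w)].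

End martingale.

Section mean_field.
Variables (R : realType) (I : choiceType) (c : I -> {posnum R}).
Variables (nbr : rel I) (kappa : R).

Local Notation E := (ell2 c).

(* Only used for finitely supported theta; on infinite supports the library sets
   this finitary sum to 0. *)
Definition pairing (v theta : I -> R) : R := \sum_(x \in [set: I]) v x * theta x.

(* The sums range over the finite set of neighbors of x.  The library sets the
   integral to an arbitrary real value when u_x u_y is not nu-integrable, which
   cannot happen under in_P1 below, by Cauchy-Schwarz. *)
Definition drift (v : I -> R) (nu : probability (borel E) R) (x : I) : R :=
  2 * kappa * (\sum_(y \in [set y | nbr x y]) v y)
  - 2 * kappa *
      (\sum_(y \in [set y | nbr x y]) \int[nu]_u ((u : E) x * (u : E) y)) * v x
  - 2^-1 * v x.

Section solution.
Variable T : R.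

Local Notation Omega := (borel (path_space E T)).

(* sigma(pi_s : s <= t) *)
Definition path_filtration (t : R) : set (set Omega) :=
  <<s [set A | exists2 s, 0 <= s <= t &
                 exists2 B : set (borel E), measurable B & A = @eval_path _ E T s @^-1` B] >>.

Variable P : probability Omega R.

Definition marginal (s : R) : probability (borel E) R :=
  distribution P (@eval_path _ E T s).

Definition mf_drift (s : R) (w : Omega) : I -> R :=
  drift (eval_path s w : E) (marginal s).

Definition mf_process (theta : I -> R) (t : R) (w : Omega) : R :=
  pairing (eval_path t w : E) theta - pairing (eval_path 0 w : E) theta
  - \int[lebesgue_measure]_(s in `[0, t]) pairing (mf_drift s w) theta.

Definition martingale_solution (mu0 : probability (borel E) R) : Prop :=
  [/\ same_law (marginal 0) mu0,
      {ae P, forall w,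
        (\int[lebesgue_measure]_(s in `[0%R, T]) enorm c (mf_drift s w) < +oo)%E} &
      forall theta : I -> R, finite_set [set x | theta x != 0] ->
        let M := mf_process theta in
        [/\ martingale P T path_filtration M,
            as_continuous P T M,
            square_integrable P T M &
            quadratic_variation P T path_filtration M
              (fun t _ => t * \sum_(x \in [set: I]) theta x ^+ 2)]].

End solution.

(* The time horizon T is arbitrary, and P may depend on it. *)
Definition stationary (mu : probability (borel E) R) : Prop :=
  forall T, 0 < T -> exists P : probability (borel (path_space E T)) R,
    martingale_solution P mu /\
    forall t, 0 <= t <= T -> same_law (marginal P t) mu.

Definition in_P1 (mu : probability (borel E) R) : Prop :=
  forall x, (\int[mu]_v (((v : E) x) ^+ 2)%:E <= 1)%E.

End mean_field.

Section lattices.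
Variable d : nat.

(* y is obtained from x by moving one coordinate to its successor: k + 1 in Z,
   k + 1 mod L on the torus. *)
Definition step (J : eqType) (succ : J -> J) (x y : {ffun 'I_d -> J}) : bool :=
  [exists i, (y i == succ (x i)) && [forall j, (j != i) ==> (y j == x j)]].

(* x != y only matters on the torus of side 1, which has no edges. *)
Definition neighbor (J : eqType) (succ : J -> J) (x y : {ffun 'I_d -> J}) : bool :=
  (x != y) && (step succ x y || step succ y x).

Definition Zd : choiceType := {ffun 'I_d -> int}.
Definition Zd_neighbor : rel Zd := neighbor (fun k : int => k + 1).

Variable L : nat.
Definition torus : finType := {ffun 'I_d -> 'I_L}.
Definition torus_neighbor : rel torus := neighbor (@ordS L).

End lattices.

(* The lengths of the paths from x to y in the graph e *)
Definition path_length (I : eqType) (e : rel I) (x y : I) : set nat :=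
  [set n | exists p, [/\ path e x p, last x p = y & size p = n]].

(* The length of a shortest path, or 0 if there is none (never on Z^d, which is
   connected). *)
Definition graph_dist (I : eqType) (e : rel I) (x y : I) : nat :=
  xget 0%N [set n | path_length e x y n /\
                    forall m, path_length e x y m -> (n <= m)%N].

Definition Zd_abs d (x : Zd d) : nat := graph_dist (@Zd_neighbor d) [ffun=> 0] x.

Lemma Zd_weight_subproof (R : realType) (a : R) d (x : Zd d) :
  1 < a -> 0 < a ^- Zd_abs x.
Proof. by move=> a1; rewrite invr_gt0 exprn_gt0// (lt_trans ltr01). Qed.

Definition Zd_weight (R : realType) (a : R) (a1 : 1 < a) d (x : Zd d) : {posnum R} :=
  PosNum (Zd_weight_subproof x a1).

Definition unit_weight (R : realType) (I : choiceType) (x : I) : {posnum R} := 1%:pos.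

Lemma finite_neighbor d (J : choiceType) (succ pred : J -> J)
    (x : {ffun 'I_d -> J}) : cancel succ pred ->
  finite_set [set y | neighbor succ x y].
Proof.
move=> succK.
pose upd (h : J -> J) i : {ffun 'I_d -> J} := [ffun j => if j == i then h (x j) else x j].
apply: (@sub_finite_set _ _ (range (upd succ) `|` range (upd pred))).
  move=> y /andP[_ /orP[] /existsP[i /andP[/eqP yi /forallP yj]]]; [left|right];
    exists i => //; apply/ffunP => j; rewrite ffunE.
    by have := yj j; case: eqVneq => [->|_ /= /eqP].
  by have := yj j; case: eqVneq => [->|_ /= /eqP //]; rewrite yi succK.
by rewrite finite_setU; split; apply: finite_image; exact: finite_finset.
Qed.

Lemma Zd_neighbor_finite d (x : Zd d) : finite_set [set y | Zd_neighbor x y].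
Proof. by apply: (@finite_neighbor _ _ _ (fun k => k - 1)) => k; rewrite addrK. Qed.

Lemma Zd_abs_l1 d (x : Zd d) : Zd_abs x = (\sum_i `|x i|)%N.
Proof.
pose l1 (x : Zd d) := (\sum_i `|x i|)%N.
have lip (y z : Zd d) : Zd_neighbor y z -> (l1 z <= (l1 y).+1)%N.
  move=> /andP[_ yz].
  have [i [zi zj]] : exists i, (`|z i| <= `|y i|.+1)%N /\ forall j, j != i -> z j = y j.
    case/orP: yz => /existsP[i /andP[/eqP e /forallP h]]; exists i; split.
    - by rewrite e /=; lia.
    - by move=> j ji; apply/eqP/(implyP (h j)).
    - by rewrite e /=; lia.
    - by move=> j ji; apply/esym/eqP/(implyP (h j)).
  rewrite /l1 (bigD1 i)//= [X in (_ <= X.+1)%N](bigD1 i)//= -addSn leq_add//.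
  by rewrite leq_eqVlt; apply/orP; left; apply/eqP/eq_bigr => j /zj ->.
have lb (p : seq (Zd d)) y : path (@Zd_neighbor d) y p -> (l1 (last y p) <= l1 y + size p)%N.
  elim: p y => [|z p ih] y /=; first by rewrite addn0.
  by move=> /andP[/lip yz /ih] /leq_trans; apply; rewrite addnS -addSn leq_add2r.
have ub n (y : Zd d) : l1 y = n -> path_length (@Zd_neighbor d) [ffun=> 0] y n.
  elim: n y => [|n ih] y yn.
    exists [::]; split=> //=; apply/ffunP => i; rewrite ffunE; apply/esym/eqP.
    by move/eqP : yn; rewrite sum_nat_eq0 => /forallP/(_ i); rewrite absz_eq0.
  have [i yi] : exists i, y i != 0.
    apply/existsP; apply: contraPT yn => /existsPn yn; rewrite /l1 big1// => i _.
    by have := yn i; rewrite negbK => /eqP ->.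
  pose z : Zd d := [ffun j => if j == i then (if 0 < y j then y j - 1 else y j + 1) else y j].
  have zy j : j != i -> z j = y j by rewrite ffunE => /negPf ->.
  have zi : `|y i|%N = `|z i|%N.+1.
    by rewrite ffunE eqxx; case: ifPn => h; move: yi h; lia.
  have /ih[p [pp lp sp]] : l1 z = n.
    apply/eqP; rewrite -eqSS -yn /l1 (bigD1 i)//= [X in _ == X](bigD1 i)//= zi -addSn eqn_add2l.
    by apply/eqP/eq_bigr => j /zy ->.
  exists (rcons p y); rewrite size_rcons sp last_rcons rcons_path pp lp; split=> //=.
  apply/andP; split.
    by apply: contra_neq yi => h; move: zi; rewrite h; lia.
  have hz : z i = if 0 < y i then y i - 1 else y i + 1 by rewrite ffunE eqxx.
  case: ifPn hz => h hz; apply/orP; [left|right]; apply/existsP; exists i;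
    apply/andP; split; try (by rewrite hz ?subrK);
    by apply/forallP => j; apply/implyP => /zy ->.
apply: xget_subset1 => [|m n [pm hm] [pn hn]]; last first.
  by apply/eqP; rewrite eqn_leq hm// hn.
split=> [|m [p [pp <- <-]]]; first exact: ub.
have := lb _ _ pp; rewrite [l1 [ffun=> _]]big1// => i _; by rewrite ffunE.
Qed.

Lemma finite_norm2_fin (R : realType) (I : finType) (c : I -> {posnum R}) (v : I -> R) :
  v \in finite_norm2 c.
Proof.
have fI : finite_set [set: I] by exact: finite_finset.
apply/asboolP; rewrite /enorm2 esum_fset//.
  by rewrite fsbig_finite//= sumEFin ltry.
by move=> x _; exact: enorm2_term_ge0.
Qed.

Lemma enormE (R : realType) (I : choiceType) (c : I -> {posnum R}) (v : ell2 c) :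
  enorm c v = `|v|%:E.
Proof.
rewrite [in RHS]/Num.norm/= /ell2_norm /enorm.
by case: (enorm2 c v) (ell2_fin v).
Qed.

(* Main.v *)
Require Import Defs.
From HB Require Import structures.
From mathcomp Require Import all_boot all_order all_algebra.
From mathcomp Require Import all_classical all_reals all_analysis.
From mathcomp Require Import measurable_realfun ring lra.

Set Implicit Arguments.
Unset Strict Implicit.
Unset Printing Implicit Defensive.

Import Order.TTheory GRing.Theory Num.Theory.
Import numFieldNormedType.Exports.

Local Open Scope classical_set_scope.
Local Open Scope ring_scope.

(** A stationary law has constant moments, so that along a stationary solution the
    mean-field drift is the linear field
      [2 kappa sum_y v_y - (2 kappa b_x + 1/2) v_x],   [b_x = sum_y E[v_x v_y]],
    and the solution is an Ornstein-Uhlenbeck process driven by unit white noise.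
    Uniqueness has two steps.

    The covariances [C_xz = E[v_x v_z]] satisfy the Lyapunov equation of this process,
      [(2 kappa (b_x + b_z) + 1) C_xz
         - 2 kappa (sum_y C_xy + sum_y C_zy) = delta_xz]
    with [y] running over the neighbors of [z], respectively of [x]
    ([corr_equation]). As [|C| <= 1], the difference of two solutions contracts in the
    supremum norm when [kappa] is small ([corr_unique]). Hence two stationary
    laws have the same [b], that is the same linear drift [A].

    The characteristic function [phi] of a stationary law then satisfies
    [phi s = exp (- t |s|^2 / 2) phi (s + t A s)] up to a small error ([char_step]). The
    difference of the characteristic functions of two stationary laws therefore does not
    decrease along the flow of [A], up to the errors; the flow contracts the l^1 norm
    ([nrm_euler]), and at the origin both functions are [1]. So they agree
    ([char_unique]). Euler steps keep the support of [s] finite, and their errors, of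
    order [t^(3/2)] times the norm, sum up to the order [t^(1/2)].

    The probabilistic input is that a continuous martingale [M] for which [M^2 - q t] is
    a martingale is Gaussian given the past ([levy]). This is proved without stochastic
    integrals, by telescoping [exp (q t / 2) cos (H + M_t)] along a grid that is abandoned
    at the first large increment. The remaining estimates are second moment bounds:
    freezing the drift over a time [T] costs an error of size [T^(3/2)] in L^2
    ([L2_remainder]).

    Finally the law is determined by its characteristic function ([char_same_law]):
    bounded pointwise limits of trigonometric polynomials form an algebra that contains the
    indicators of coordinate half-spaces, and these generate the Borel sets of the
    separable space [ell2]. *)

(** * Expectations and square-integrable variables *)

Section expectation.
Context d (Om : measurableType d) (R : realType) (P : probability Om R).
Implicit Types X Y : Om -> R.

Local Notation mfun X := (measurable_fun [set: Om] X).
Local Notation intg X := (P.-integrable [set: Om] (EFin \o X)).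
Local Notation EX X := (\int[P]_w X w).

Lemma intg_mfun X : intg X -> mfun X.
Proof. by move=> /(measurable_int P) /measurable_EFinP. Qed.

Lemma intg_bounded X B : mfun X -> (forall w, `|X w| <= B) -> intg X.
Proof.
move=> mX XB; apply: (@le_integrable _ _ _ _ _ measurableT _ (EFin \o cst B)).
- exact/measurable_EFinP.
- by move=> w _ /=; rewrite lee_fin (le_trans (XB w))// ler_norm.
- exact: finite_measure_integrable_cst.
Qed.

Lemma intg_le X Y : mfun X -> (forall w, `|X w| <= Y w) -> intg Y -> intg X.
Proof.
move=> mX XY; apply: le_integrable => //; first exact/measurable_EFinP.
by move=> w _ /=; rewrite lee_fin (le_trans (XY w))// ler_norm.
Qed.

Lemma intgD X Y : intg X -> intg Y -> intg (fun w => X w + Y w).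
Proof. by move=> iX iY; exact: (integrableD measurableT iX iY). Qed.

Lemma intgB X Y : intg X -> intg Y -> intg (fun w => X w - Y w).
Proof. by move=> iX iY; exact: (integrableB measurableT iX iY). Qed.

Lemma intgZ (k : R) X : intg X -> intg (fun w => k * X w).
Proof. by move=> iX; exact: (integrableZl measurableT k iX). Qed.

Lemma intg_norm X : intg X -> intg (fun w => `|X w|).
Proof. exact: integrable_norm. Qed.

Lemma intg_cst (k : R) : intg (fun=> k).
Proof. exact: finite_measure_integrable_cst. Qed.

Lemma EX_cst (k : R) : EX (fun=> k) = k.
Proof.
rewrite Rintegral_cst// (_ : fine _ = 1) ?mulr1//.
exact: (congr1 fine (probability_setT P)).
Qed.

Lemma EXD X Y : intg X -> intg Y -> EX (fun w => X w + Y w) = EX X + EX Y.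
Proof. by move=> iX iY; rewrite RintegralD. Qed.

Lemma EXB X Y : intg X -> intg Y -> EX (fun w => X w - Y w) = EX X - EX Y.
Proof. by move=> iX iY; rewrite RintegralB. Qed.

Lemma EXZ k X : intg X -> EX (fun w => k * X w) = k * EX X.
Proof. by move=> iX; rewrite RintegralZl. Qed.

Lemma le_EX X Y : intg X -> intg Y -> (forall w, X w <= Y w) -> EX X <= EX Y.
Proof. by move=> iX iY XY; apply: le_Rintegral. Qed.

Lemma le_norm_EX X Y : intg X -> intg Y -> (forall w, `|X w| <= Y w) ->
  `|EX X| <= EX Y.
Proof.
move=> iX iY XY; apply: (le_trans (le_normr_Rintegral measurableT iX)).
by apply: le_EX => //; exact: intg_norm.
Qed.

Lemma intg_sum (I : Type) (r : seq I) (X : I -> Om -> R) :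
  (forall i, intg (X i)) -> intg (fun w => \sum_(i <- r) X i w).
Proof.
move=> iX; elim: r => [|i r ih].
  by under [X in EFin \o X]eq_fun do rewrite big_nil; exact: intg_cst.
under [X in EFin \o X]eq_fun do rewrite big_cons.
exact: intgD.
Qed.

Lemma EX_sum (I : Type) (r : seq I) (X : I -> Om -> R) :
  (forall i, intg (X i)) ->
  EX (fun w => \sum_(i <- r) X i w) = \sum_(i <- r) EX (X i).
Proof.
move=> iX; elim: r => [|i r ih].
  by under eq_Rintegral do rewrite big_nil; rewrite EX_cst big_nil.
under eq_Rintegral do rewrite big_cons.
by rewrite EXD ?ih ?big_cons//; exact: intg_sum.
Qed.

Lemma EX_indic (A : set Om) : measurable A -> EX (\1_A) = fine (P A).
Proof. by move=> mA; rewrite /Rintegral integral_indic// setIT. Qed.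

Lemma intg_indicM (A : set Om) X : measurable A -> intg X ->
  intg (fun w => \1_A w * X w).
Proof.
move=> mA iX; apply: (intg_le _ _ (intg_norm iX)).
  by apply: measurable_funM; [exact: measurable_indic|exact: intg_mfun].
move=> w; rewrite normrM ler_piMl// indicE.
by case: (w \in A); rewrite ?normr1 ?normr0.
Qed.

Lemma EX_indicM (A : set Om) X : measurable A ->
  EX (fun w => \1_A w * X w) = \int[P]_(w in A) X w.
Proof.
move=> mA; rewrite [RHS]Rintegral_mkcond; apply: eq_Rintegral => w _.
by rewrite /patch indicE; case: (w \in A); rewrite ?mul1r ?mul0r.
Qed.

Lemma dct_cvg (X_ : nat -> Om -> R) X Y :
  (forall n, mfun (X_ n)) -> mfun X -> intg Y ->
  {ae P, forall w, X_ n w @[n --> \oo] --> X w} ->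
  (forall n w, `|X_ n w| <= Y w) ->
  EX (X_ n) @[n --> \oo] --> EX X.
Proof.
move=> mX_ mX iY cX XY.
have mE (Z : Om -> R) : mfun Z -> measurable_fun setT (EFin \o Z).
  by move=> mZ; exact/measurable_EFinP.
have [|||iX _ h] := @dominated_convergence _ _ _ P setT measurableT
  (fun n => EFin \o X_ n) (EFin \o X) (EFin \o Y) (fun n => mE _ (mX_ n)) (mE _ mX).
- by apply: filterS cX => w cw _; apply: cvg_EFin => //; exact: nearW.
- exact: iY.
- by apply: aeW => w n _ /=; rewrite lee_fin.
apply: fine_cvg; rewrite fineK//.
exact: integrable_fin_num.
Qed.

(** Dominated convergence: almost surely only finitely many of the [A n] occur,
    so the integrand is eventually zero. *)
Lemma EX_vanishing_sets (A : nat -> set Om) X : intg X ->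
  (forall n, measurable (A n)) ->
  {ae P, forall w, \forall n \near \oo, ~ A n w} ->
  EX (fun w => \1_(A n) w * X w) @[n --> \oo] --> 0.
Proof.
move=> iX mA cA; rewrite [X in _ --> X](_ : 0 = EX (fun=> 0)); last by rewrite EX_cst.
apply: (@dct_cvg _ _ (fun w => `|X w|)) => //.
- by move=> n; apply: intg_mfun; exact: intg_indicM.
- exact: intg_norm.
- apply: filterS cA => w cw; apply: cvg_near_cst; apply: filterS cw => n nA.
  by rewrite indicE memNset// mul0r.
- move=> n w; rewrite normrM ler_piMl// indicE.
  by case: (w \in A n); rewrite ?normr1 ?normr0.
Qed.

Definition L2 X := mfun X /\ intg (fun w => X w ^+ 2).

Lemma L2_intgM X Y : L2 X -> L2 Y -> intg (fun w => X w * Y w).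
Proof.
move=> [mX iX] [mY iY]; apply: (intg_le _ _ (intgD iX iY)).
  exact: measurable_funM.
by move=> w; rewrite ler_norml; apply/andP; split; nra.
Qed.

Lemma L2D X Y : L2 X -> L2 Y -> L2 (fun w => X w + Y w).
Proof.
move=> LX LY; have iXY := L2_intgM LX LY; case: LX LY => [mX iX] [mY iY].
split; first exact: measurable_funD.
apply: (intg_le _ _ (intgZ 2 (intgD iX iY))).
  by apply: measurable_funX; exact: measurable_funD.
move=> w; rewrite ger0_norm ?sqr_ge0//.
by have := sqr_ge0 (X w - Y w); nra.
Qed.

Lemma L2Z k X : L2 X -> L2 (fun w => k * X w).
Proof.
move=> [mX iX]; split; first exact: measurable_funM.
under [X in EFin \o X]eq_fun do rewrite exprMn.
exact: intgZ.
Qed.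

Lemma L2B X Y : L2 X -> L2 Y -> L2 (fun w => X w - Y w).
Proof.
move=> LX LY; have := L2D LX (L2Z (-1) LY).
by under [X in L2 X -> _]eq_fun do rewrite mulN1r.
Qed.

Lemma L2_cst k : L2 (fun=> k).
Proof. by split=> //; exact: intg_cst. Qed.

Lemma L2_sum (I : Type) (r : seq I) (X : I -> Om -> R) :
  (forall i, L2 (X i)) -> L2 (fun w => \sum_(i <- r) X i w).
Proof.
move=> iX; elim: r => [|i r ih].
  by under [X in L2 X]eq_fun do rewrite big_nil; exact: L2_cst.
by under [X in L2 X]eq_fun do rewrite big_cons; exact: L2D.
Qed.

Lemma L2_intg X : L2 X -> intg X.
Proof.
move=> /L2_intgM /(_ (L2_cst 1)).
by under [X in EFin \o X]eq_fun do rewrite mulr1.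
Qed.

Lemma L2P X (m : R) : mfun X -> (\int[P]_w ((X w) ^+ 2)%:E <= m%:E)%E ->
  L2 X /\ EX (fun w => X w ^+ 2) <= m.
Proof.
move=> mX Xm; have iX : intg (fun w => X w ^+ 2).
  apply/integrableP; split.
    by apply/measurable_EFinP; exact: measurable_funX.
  under eq_integral do rewrite /= ger0_norm ?sqr_ge0//.
  by rewrite (le_lt_trans Xm)// ltry.
split=> //; rewrite /Rintegral -lee_fin fineK//.
exact: (integrable_fin_num measurableT iX).
Qed.

(** Jensen's inequality, from [2 |x| <= x^2 / m + m]. *)
Lemma L2_norm1 X m : 0 <= m -> L2 X -> EX (fun w => X w ^+ 2) <= m ^+ 2 ->
  EX (fun w => `|X w|) <= m.
Proof.
move=> m0 LX Xm.
(* m may vanish, hence the perturbation of the optimal constant m *)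
apply/ler_addgt0Pr => e e0.
have : EX (fun w => `|X w|) <= EX (fun w => (2 * (m + e))^-1 * X w ^+ 2 + (m + e) / 2).
  apply: le_EX; [exact/intg_norm/L2_intg| |].
    by apply: intgD; [apply: intgZ; case: LX|exact: intg_cst].
  move=> w; rewrite -(real_normK (num_real (X w))).
  have := sqr_ge0 (`|X w| - (m + e)); set x := `|X w|.
  have mi : 0 < (2 * (m + e))^-1 by rewrite invr_gt0; lra.
  move=> /(mulr_ge0 (ltW mi)).
  have -> : (2 * (m + e))^-1 * (x - (m + e)) ^+ 2 =
      (2 * (m + e))^-1 * x ^+ 2 + (m + e) / 2 - x by field; lra.
  by lra.
have [_ iX] := LX; have iX' := intgZ (2 * (m + e))^-1 iX.
rewrite EXD ?EXZ ?EX_cst//; do ?exact: intg_cst.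
move=> /le_trans; apply.
have : (2 * (m + e))^-1 * EX (fun w => X w ^+ 2) <= (2 * (m + e))^-1 * (m + e) ^+ 2.
  rewrite ler_wpM2l//; last by rewrite (le_trans Xm)//; nra.
  by rewrite invr_ge0; lra.
have -> : (2 * (m + e))^-1 * (m + e) ^+ 2 = (m + e) / 2 by field; lra.
by lra.
Qed.

End expectation.

(** * Elementary real analysis *)

Section real_analysis.
Context (R : realType).
Implicit Types f df : R -> R.

Lemma nonneg_of_derive f df : (forall x : R, is_derive x (1 : R) f (df x)) ->
  (forall x, 0 <= x -> 0 <= df x) -> f 0 = 0 -> forall x, 0 <= x -> 0 <= f x.
Proof.
move=> fdf df0 f0 x x0.
have [c cx E] := @MVT_segment R f df 0 x x0 (fun y _ => fdf y)
  (derivable_within_continuous (fun y _ => @ex_derive _ _ _ _ _ _ _ (fdf y))).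
have -> : f x = df c * (x - 0) by rewrite -E f0 subr0.
rewrite mulr_ge0 ?subr_ge0// df0//.
by move: cx; rewrite in_itv/= => /andP[].
Qed.

Lemma sin_le (x : R) : 0 <= x -> sin x <= x.
Proof.
move=> x0; rewrite -subr_ge0; move: x x0.
apply: (@nonneg_of_derive _ (fun x => 1 - cos x)) => //.
by rewrite sin0 subrr.
Qed.

Lemma cos_ge (x : R) : 1 - x ^+ 2 / 2 <= cos x.
Proof.
wlog x0 : x / 0 <= x.
  move=> h; have [/h//|x0] := leP 0 x.
  by rewrite -cosN -sqrrN h// oppr_ge0 ltW.
suff : 0 <= cos x - 1 + x ^+ 2 / 2 by lra.
move: x x0; apply: (@nonneg_of_derive _ (fun x => x - sin x)) => //.
- move=> x; apply: is_derive_eq; rewrite /GRing.scale/=; lra.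
- by move=> x /sin_le; rewrite subr_ge0.
- by rewrite cos0 expr0n/= mul0r addr0 subrr.
Qed.

Lemma sin_gap (x : R) : 0 <= x ->
  [/\ 0 <= x - sin x, x - sin x <= x ^+ 2 & x - sin x <= x ^+ 3].
Proof.
move=> x0; split; first by rewrite subr_ge0 sin_le.
  rewrite -subr_ge0; move: x x0.
  apply: (@nonneg_of_derive _ (fun x => 2 * x - (1 - cos x))).
  - move=> x; apply: is_derive_eq; rewrite /GRing.scale/=; lra.
  - move=> x x0; have := cos_ge x; have := cos_geN1 x.
    by have [x1|x1] := leP x 1; nra.
  - by rewrite sin0 expr0n/= !subrr.
rewrite -subr_ge0; move: x x0.
apply: (@nonneg_of_derive _ (fun x => 3 * x ^+ 2 - (1 - cos x))).
- move=> x; apply: is_derive_eq; rewrite /GRing.scale/=; lra.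
- by move=> x x0; have := cos_ge x; have := sqr_ge0 x; lra.
- by rewrite sin0 expr0n/= !subrr.
Qed.

Lemma cos_gap (x : R) : 0 <= x ->
  [/\ 0 <= cos x - 1 + x ^+ 2 / 2, cos x - 1 + x ^+ 2 / 2 <= x ^+ 2 &
      cos x - 1 + x ^+ 2 / 2 <= x ^+ 3].
Proof.
move=> x0; split; first by have := cos_ge x; lra.
  by have := cos_le1 x; have := sqr_ge0 x; lra.
rewrite -subr_ge0; move: x x0.
apply: (@nonneg_of_derive _ (fun x => 3 * x ^+ 2 - (x - sin x))).
- move=> x; apply: is_derive_eq; rewrite /GRing.scale/=; lra.
- by move=> x /sin_gap[_]; have := sqr_ge0 x; lra.
- by rewrite cos0 !expr0n/= mul0r addr0 !subrr.
Qed.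

(** The remainder is bounded both cubically and quadratically: the cubic bound
    serves for the small increments of a martingale, the quadratic one for the
    rare large increments, about which only second moments are known. *)
Lemma cos_taylor2 (a x : R) :
  let r := cos (a + x) - cos a + sin a * x + cos a * (x ^+ 2 / 2) in
  `|r| <= 2 * x ^+ 2 /\ `|r| <= 2 * `|x| ^+ 3.
Proof.
wlog x0 : a x / 0 <= x.
  move=> h; have [/(h a)//|x0] := leP 0 x.
  have := h (- a) (- x); rewrite oppr_ge0 (ltW x0) => /(_ isT).
  by rewrite -opprD !cosN sinN normrN sqrrN mulrNN.
move=> r; have -> : r = cos a * (cos x - 1 + x ^+ 2 / 2) + sin a * (x - sin x).
  by rewrite /r cosD; ring.
have [s0 s2 s3] := sin_gap x0; have [c0 c2 c3] := cos_gap x0.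
rewrite (ger0_norm x0).
have le : `|cos a * (cos x - 1 + x ^+ 2 / 2) + sin a * (x - sin x)| <=
   (cos x - 1 + x ^+ 2 / 2) + (x - sin x).
  rewrite (le_trans (ler_normD _ _))// !normrM (ger0_norm s0) (ger0_norm c0).
  by rewrite lerD// ler_piMl// ler_norml ?cos_le1 ?cos_geN1 ?sin_le1 ?sin_geN1.
by split; apply: (le_trans le); lra.
Qed.

Lemma cos_lip (x y : R) : `|cos x - cos y| <= `|x - y|.
Proof.
wlog xy : x y / x <= y.
  move=> h; have [/h//|/ltW/h] := leP x y.
  by rewrite distrC [leRHS]distrC.
have [c _ E] := @MVT_segment R cos (fun x => - sin x) x y xy
  (fun y _ => is_derive_cos y) (continuous_subspaceT (@continuous_cos R)).
rewrite distrC E normrM normrN [leRHS]distrC ler_piMl//.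
by rewrite ler_norml sin_geN1 sin_le1.
Qed.

Lemma expR_gap (x : R) : 0 <= x -> `|1 - x - expR (- x)| <= x ^+ 2.
Proof.
move=> x0; have h := expR_ge1Dx (- x); have h2 := expR_ge1Dx x.
have : expR (- x) * expR x = 1 by rewrite expRN mulVf// gt_eqF ?expR_gt0.
have := expR_gt0 (- x); set e := expR (- x) in h *; set f := expR x in h2 * => e0 ef.
by rewrite ler_norml; apply/andP; split; nra.
Qed.

(** Uniform continuity on a segment: near each point half of the local modulus of
    continuity is a common modulus, and compactness globalizes it. *)
Lemma heine (T : R) f : {within `[0, T], continuous f} ->
  forall e, 0 < e -> exists2 del, 0 < del &
    forall x y, x \in `[0, T] -> y \in `[0, T] -> `|x - y| < del -> `|f x - f y| < e.
Proof.
move=> cf e e0.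
have /compact_near_coveringP/near_covering_withinP := @segment_compact R 0 T.
move=> /(_ _ (0 : R)^'+ (fun del x => forall y, y \in `[0, T] ->
   `|x - y| < del -> `|f x - f y| < e)) h.
have {h} : \forall del \near (0 : R)^'+, `[0, T] `<=` (fun x => forall y, y \in `[0, T] ->
   `|x - y| < del -> `|f x - f y| < e).
  apply: h => x xT.
  have /subspace_continuousP/(_ x xT)/cvgrPdist_lt/(_ (e / 2)) := cf.
  rewrite divr_gt0// => /(_ isT)/nbhs_ballP[/= del d0 Hd].
  near=> x' z => /= x'T y yT xy.
  have x'd : `|x - x'| < del / 2 by near: x'; exists (del / 2) => //=; rewrite divr_gt0.
  have zd : z < del / 2 by near: z; exact: nbhs_right_lt (divr_gt0 d0 _).
  have h1 := Hd x'; rewrite /ball/= in h1.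
  have h2 := Hd y; rewrite /ball/= in h2.
  have := h1 ltac:(lra) x'T.
  have : `|x - y| < del.
    by have := ler_distD x' x y; lra.
  move=> /h2/(_ yT) {}h2 {}h1.
  by have := ler_distD (f x) (f x') (f y); rewrite (distrC (f x') (f x)); lra.
move=> [/= del d0 Hd]; exists (del / 2); first by rewrite divr_gt0.
move=> x y xT yT xy; apply: (Hd (del / 2)) => //=; last by rewrite divr_gt0.
by rewrite sub0r normrN gtr0_norm ?divr_gt0//; lra.
Unshelve. all: by end_near.
Qed.

Lemma within_continuous_bounded (T : R) f : {within `[0, T], continuous f} ->
  exists K, forall x, x \in `[0, T] -> `|f x| <= K.
Proof.
move=> cf.
have /compact_bounded[M [_ HM]] := continuous_compact cf (@segment_compact R 0 T).
exists (M + 1) => x xT; apply: (HM (M + 1)); first by rewrite ltrDl.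
by exists x.
Qed.

End real_analysis.

(** * Weights measurable with respect to the past *)

Section weights.
Context d (Om : measurableType d) (R : realType) (P : probability Om R).
Variable (G : set (set Om)).
Hypothesis GM : G `<=` measurable.

Local Notation mG h := (measurable_fun [set: g_sigma_algebraType G]
  (h : g_sigma_algebraType G -> R)).
Local Notation EX X := (\int[P]_w X w).

Lemma sub_measurable : <<s G >> `<=` (measurable : set (set Om)).
Proof. by apply: smallest_sub => //; exact: sigma_algebra_measurable. Qed.

Lemma sub_measurable_fun (h : Om -> R) : mG h -> measurable_fun [set: Om] h.
Proof.
by move=> mh mT B mB; apply: sub_measurable; exact: (mh measurableT).
Qed.

Import HBNNSimple.

(** By linearity the identity passes from events to simple weights, and by
    dominated convergence to bounded ones. It holds for constant weights, so
    that [h] may be shifted to be nonnegative. *)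
Lemma EX_bounded_weight (Y h : Om -> R) B :
  P.-integrable [set: Om] (EFin \o Y) ->
  (forall A, <<s G >> A -> \int[P]_(w in A) Y w = 0) ->
  mG h -> (forall w, `|h w| <= B) -> EX (fun w => h w * Y w) = 0.
Proof.
move=> iY Y0 mh hB.
wlog h0 : h mh B hB / forall w, 0 <= h w.
  move=> H.
  have {}hB w : - B <= h w <= B by rewrite -ler_norml.
  have ihY : P.-integrable [set: Om] (EFin \o (fun w => (h w + B) * Y w)).
    apply: (intg_le (Y := fun w => (B + B) * `|Y w|)).
    - apply: measurable_funM; last exact: intg_mfun iY.
      by apply: measurable_funD => //; exact: sub_measurable_fun.
    - move=> w; rewrite normrM ler_wpM2r//.
      by have /andP[h1 h2] := hB w; rewrite ger0_norm; lra.
    - by apply: intgZ; exact: intg_norm.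
  have -> : EX (fun w => h w * Y w) = EX (fun w => (h w + B) * Y w - B * Y w).
    by apply: eq_Rintegral => w _; ring.
  rewrite EXB//; last exact: intgZ.
  rewrite EXZ// [X in _ - _ * X]Y0 ?mulr0 ?subr0; last exact: (@measurableT _ (g_sigma_algebraType G)).
  apply: (H _ _ (B + B)).
  - by apply: measurable_funD.
  - by move=> w; have /andP[h1 h2] := hB w; rewrite ger0_norm; lra.
  - by move=> w; have /andP[h1 h2] := hB w; lra.
have mhE : measurable_fun [set: g_sigma_algebraType G]
    (EFin \o (h : g_sigma_algebraType G -> R)) by exact/measurable_EFinP.
pose g := nnsfun_approx measurableT mhE.
have gcvg w : EFin \o g ^~ w @ \oo --> (h w)%:E.
  by apply: (cvg_nnsfun_approx measurableT mhE) => // t _ /=; rewrite lee_fin.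
have gh n w : g n w <= h w.
  rewrite /g nnsfun_approxE -lee_fin.
  by apply: (@le_approx _ _ _ setT) => // t _ /=; rewrite lee_fin.
have mg n : measurable_fun [set: Om] (g n).
  by apply: sub_measurable_fun; exact: (measurable_funP (g n)).
have : EX (fun w => g n w * Y w) @[n --> \oo] --> EX (fun w => h w * Y w).
  apply: (dct_cvg (Y := fun w => B * `|Y w|)).
  - by move=> n; apply: measurable_funM => //; exact: intg_mfun iY.
  - apply: measurable_funM; first exact: sub_measurable_fun.
    exact: intg_mfun iY.
  - by apply: intgZ; exact: intg_norm.
  - by apply: aeW => w; apply: cvgMl; have /fine_cvgP[] := gcvg w.
  - move=> n w; rewrite normrM ler_wpM2r// ger0_norm ?fun_ge0//.
    by rewrite (le_trans (gh n w))// (le_trans (ler_norm _))// hB.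
have -> : (fun n => EX (fun w => g n w * Y w)) = (fun=> 0).
  apply/funext => n.
  have E w : g n w * Y w = \sum_(y <- finmap.enum_fset (fset_set (range (g n : Om -> R))))
      (y * (\1_(g n @^-1` [set y]) w * Y w)).
    rewrite [X in X * _](fimfunE (g n) w) fsbig_finite//= mulr_suml.
    by apply: eq_bigr => y _; rewrite mulrA.
  under eq_Rintegral do rewrite E.
  have sg y : <<s G >> (g n @^-1` [set y]).
    rewrite -[X in <<s G >> X]setTI.
    by apply: (measurable_funP (g n)).
  rewrite EX_sum; last first.
    by move=> y; apply: intgZ; apply: intg_indicM => //; exact: sub_measurable.
  rewrite big1// => y _; rewrite EXZ; last first.
    by apply: intg_indicM => //; exact: sub_measurable.
  by rewrite EX_indicM ?Y0 ?mulr0//; exact: sub_measurable.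
move=> /cvg_lim <-//; exact: lim_cst.
Qed.

End weights.

Section martingale_increments.
Context d (Om : measurableType d) (R : realType) (P : probability Om R).
Variables (T : R) (F : R -> set (set Om)) (M : R -> Om -> R) (q : R).
Hypothesis FS : forall t, sigma_algebra [set: Om] (F t).
Hypothesis FM : forall t, F t `<=` measurable.
Hypothesis Fle : forall s t, s <= t -> F s `<=` F t.
Hypothesis MM : martingale P T F M.
Hypothesis MQ : martingale P T F (fun t w => (M t w) ^+ 2 - t * q).

Local Notation mF t h := (measurable_fun [set: g_sigma_algebraType (F t)]
  (h : g_sigma_algebraType (F t) -> R)).
Local Notation intg X := (P.-integrable [set: Om] (EFin \o X)).
Local Notation EX X := (\int[P]_w X w).

Lemma mF_sub s t h : s <= t -> mF s h -> mF t h.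
Proof.
move=> st mh mT B mB; have := mh measurableT B mB.
by rewrite !setTI; apply: sub_sigma_algebra2; exact: Fle.
Qed.

Lemma mF_mfun t h : mF t h -> measurable_fun [set: Om] h.
Proof. exact: sub_measurable_fun. Qed.

Lemma mF_martingale s t : 0 <= s -> s <= t -> t <= T -> mF t (M s).
Proof.
move=> s0 st tT; apply: (mF_sub st) => mT B mB; rewrite setTI.
apply: sub_sigma_algebra; case: MM => + _ _; apply=> //.
by rewrite in_itv/= s0 (le_trans st).
Qed.

Lemma intg_martingale t : 0 <= t -> t <= T -> intg (M t).
Proof. by move=> t0 tT; case: MM => _ + _; apply; rewrite in_itv/= t0. Qed.

Lemma intg_martingale2 t : 0 <= t -> t <= T -> intg (fun w => M t w ^+ 2).
Proof.
move=> t0 tT; have [_ /(_ t) + _] := MQ; rewrite in_itv/= t0 tT => /(_ isT) iN.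
have := intgD iN (intg_cst P (t * q)).
by under [X in EFin \o X]eq_fun do rewrite subrK.
Qed.

Lemma Rint_sub_eq0 (A : set Om) (X Y : Om -> R) : measurable A ->
  intg X -> intg Y ->
  (\int[P]_(w in A) (X w)%:E = \int[P]_(w in A) (Y w)%:E)%E ->
  \int[P]_(w in A) (Y w - X w) = 0.
Proof.
move=> mA iX iY XY.
have iA Z : intg Z -> P.-integrable A (EFin \o Z) by apply: integrableS.
by rewrite RintegralB ?iA// /Rintegral XY subrr.
Qed.

Lemma EX_weight_increment s t h B : 0 <= s -> s <= t -> t <= T ->
  mF s h -> (forall w, `|h w| <= B) -> EX (fun w => h w * (M t w - M s w)) = 0.
Proof.
move=> s0 st tT mh hB; have t0 := le_trans s0 st; have sT := le_trans st tT.
apply: (EX_bounded_weight (@FM s) _ _ mh hB).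
  by apply: intgB; exact: intg_martingale.
move=> A FA; apply: Rint_sub_eq0; [|exact: intg_martingale..|].
  exact: (sub_measurable (@FM s)).
case: MM => _ _; apply => //; move: FA; rewrite sigma_algebra_id//.
Qed.

Lemma EX_weight_increment2 s t h B : 0 <= s -> s <= t -> t <= T ->
  mF s h -> (forall w, `|h w| <= B) ->
  EX (fun w => h w * (M t w ^+ 2 - M s w ^+ 2 - q * (t - s))) = 0.
Proof.
move=> s0 st tT mh hB; have t0 := le_trans s0 st; have sT := le_trans st tT.
have i u : 0 <= u -> u <= T -> intg (fun w => M u w ^+ 2 - u * q).
  by move=> u0 uT; case: MQ => _ + _; apply; rewrite in_itv/= u0.
have -> : EX (fun w => h w * (M t w ^+ 2 - M s w ^+ 2 - q * (t - s))) =
  EX (fun w => h w * ((M t w ^+ 2 - t * q) - (M s w ^+ 2 - s * q))).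
  by apply: eq_Rintegral => w _; ring.
apply: (EX_bounded_weight (@FM s) _ _ mh hB).
  by apply: intgB; exact: i.
move=> A FA; apply: Rint_sub_eq0; [|exact: i..|].
  exact: (sub_measurable (@FM s)).
case: MQ => _ _; apply => //; move: FA; rewrite sigma_algebra_id//.
Qed.

(** Since [(b - a)^2 = b^2 - a^2 - 2 a (b - a)], the cross term is an increment
    with weight [h * M s]; this is why [M s] has to be bounded on the support
    of [h]. *)
Lemma EX_weight_square s t h B B' : 0 <= s -> s <= t -> t <= T ->
  mF s h -> (forall w, `|h w| <= B) -> (forall w, `|h w * M s w| <= B') ->
  EX (fun w => h w * ((M t w - M s w) ^+ 2 - q * (t - s))) = 0.
Proof.
move=> s0 st tT mh hB hMB; have t0 := le_trans s0 st; have sT := le_trans st tT.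
have mhM : mF s (fun w => h w * M s w).
  by apply: measurable_funM => //; exact: mF_martingale.
have -> : EX (fun w => h w * ((M t w - M s w) ^+ 2 - q * (t - s))) =
  EX (fun w => h w * (M t w ^+ 2 - M s w ^+ 2 - q * (t - s)) -
               2 * ((h w * M s w) * (M t w - M s w))).
  by apply: eq_Rintegral => w _; ring.
have iw X g C : mF s g -> (forall w, `|g w| <= C) -> intg X ->
    intg (fun w => g w * X w).
  move=> mg gC iX; apply: (intg_le _ _ (intgZ C (intg_norm iX))).
    by apply: measurable_funM; [exact: mF_mfun mg|exact: intg_mfun iX].
  by move=> w; rewrite normrM ler_wpM2r.
rewrite EXB; last 2 first.
- apply: (iw _ _ _ mh hB); apply: intgB; last exact: intg_cst.
  by apply: intgB; exact: intg_martingale2.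
- by apply/intgZ/(iw _ _ _ mhM hMB)/intgB; exact: intg_martingale.
rewrite EXZ; last by apply/(iw _ _ _ mhM hMB)/intgB; exact: intg_martingale.
rewrite (EX_weight_increment2 s0 st tT mh hB).
by rewrite (EX_weight_increment s0 st tT mhM hMB) mulr0 subrr.
Qed.

End martingale_increments.

(** * Lévy's characterization *)

Section levy.
Context d (Om : measurableType d) (R : realType) (P : probability Om R).
Variables (T : R) (F : R -> set (set Om)) (M : R -> Om -> R) (q : R).
Hypothesis T0 : 0 < T.
Hypothesis q0 : 0 <= q.
Hypothesis FS : forall t, sigma_algebra [set: Om] (F t).
Hypothesis FM : forall t, F t `<=` measurable.
Hypothesis Fle : forall s t, s <= t -> F s `<=` F t.
Hypothesis M0 : forall w, M 0 w = 0.
Hypothesis cM : as_continuous P T M.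
Hypothesis MM : martingale P T F M.
Hypothesis MQ : martingale P T F (fun t w => (M t w) ^+ 2 - t * q).
Variable H : Om -> R.
Hypothesis mH : measurable_fun [set: g_sigma_algebraType (F 0)]
  (H : g_sigma_algebraType (F 0) -> R).

Local Notation mF t h := (measurable_fun [set: g_sigma_algebraType (F t)]
  (h : g_sigma_algebraType (F t) -> R)).
Local Notation intg X := (P.-integrable [set: Om] (EFin \o X)).
Local Notation EX X := (\int[P]_w X w).

Definition grid_time n (k : nat) : R := k%:R * (T / n.+1%:R).

Definition oscillates n eps : set Om := \bigcup_(k in `I_n.+1)
  ~` [set w | `|M (grid_time n k.+1) w - M (grid_time n k) w| <= eps].

Definition exceeds K : set Om := \bigcup_n \bigcup_(k in `I_n.+2)
  ~` [set w | `|M (grid_time n k) w| <= K].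

Lemma grid_time_ge0 n k : 0 <= grid_time n k.
Proof. by rewrite mulr_ge0// divr_ge0// ltW. Qed.

Lemma grid_time_last n : grid_time n n.+1 = T.
Proof. by rewrite /grid_time mulrCA divff ?mulr1// pnatr_eq0. Qed.

Lemma grid_time_le n k : (k <= n.+1)%N -> grid_time n k <= T.
Proof.
by move=> kn; rewrite -[leRHS](grid_time_last n) ler_pM2r ?divr_gt0// ler_nat.
Qed.

Lemma grid_timeS n k : grid_time n k.+1 - grid_time n k = T / n.+1%:R.
Proof. by rewrite /grid_time -mulrBl -natrB// subSnn mul1r. Qed.

Let mM_grid n k : (k <= n.+1)%N -> measurable_fun [set: Om] (M (grid_time n k)).
Proof.
move=> kn; have t0 := grid_time_ge0 n k; have tT := grid_time_le kn.
exact: (mF_mfun FM (mF_martingale Fle MM t0 (lexx _) tT)).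
Qed.

Let measurable_norm_le (h : Om -> R) (c : R) : measurable_fun [set: Om] h ->
  measurable [set w | `|h w| <= c].
Proof.
move=> mh; have -> : [set w | `|h w| <= c] = h @^-1` `[- c, c].
  by apply/seteqP; split => w /=; rewrite in_itv/= ler_norml.
by rewrite -[X in measurable X]setTI; exact: mh.
Qed.

Lemma measurable_oscillates n eps : measurable (oscillates n eps).
Proof.
apply: bigcup_measurable => k /= kn; apply: measurableC.
by apply: measurable_norm_le; apply: measurable_funB; apply: mM_grid => //; exact: ltnW.
Qed.

Lemma measurable_exceeds K : measurable (exceeds K).
Proof.
apply: bigcup_measurable => n _; apply: bigcup_measurable => k /= kn.
by apply: measurableC; apply: measurable_norm_le; exact: mM_grid.
Qed.

Section grid.
Variables (n : nat) (eps K : R).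
Hypotheses (eps0 : 0 < eps) (K0 : 0 <= K).

Let N := n.+1.
Let del := T / N%:R.
Let t (k : nat) := grid_time n k.
Let m k w := M (t k) w.
Let D k w := m k.+1 w - m k w.

Let del0 : 0 < del. Proof. by rewrite divr_gt0. Qed.

Let t_ge0 k : 0 <= t k. Proof. exact: grid_time_ge0. Qed.

Let tS k : t k.+1 - t k = del.
Proof. exact: grid_timeS. Qed.

Let tleS k : t k <= t k.+1. Proof. by rewrite -subr_ge0 tS ltW. Qed.

Let tN : t N = T. Proof. exact: grid_time_last. Qed.

Let tleT k : (k <= N)%N -> t k <= T.
Proof. exact: grid_time_le. Qed.

(** The grid is abandoned after the first increment larger than [eps] and at the
    first value larger than [K]. Whether it is still in use at [t_k] is decided
    by time [t_k], so that [calm k] is an admissible weight for the next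
    increment; that increment may itself be large, which is the event [jump k]. *)
Fixpoint calm (k : nat) : set Om :=
  if k is k'.+1 then
    calm k' `&` [set w | `|D k' w| <= eps] `&` [set w | `|m k w| <= K]
  else setT.

Let jump k : set Om := calm k `&` ~` [set w | `|D k w| <= eps].

Let osc := oscillates n eps.

Let mM k : (k <= N)%N -> mF (t k) (m k).
Proof. by move=> kN; apply: (mF_martingale Fle MM) => //; exact: tleT. Qed.

Let mle k (h : Om -> R) (c : R) : mF (t k) h -> <<s F (t k) >> [set w | `|h w| <= c].
Proof.
move=> mh; have -> : [set w | `|h w| <= c] = h @^-1` `[- c, c].
  by apply/seteqP; split => w /=; rewrite in_itv/= ler_norml.
by rewrite -[X in <<s _ >> X]setTI; exact: mh.
Qed.

Let calm_measurable k : (k <= N)%N -> <<s F (t k) >> (calm k).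
Proof.
elim: k => [_|k ih kN] /=.
  exact: (@measurableT _ (g_sigma_algebraType (F (t 0)))).
have s2 A : <<s F (t k) >> A -> <<s F (t k.+1) >> A.
  by apply: sub_sigma_algebra2; exact: Fle.
apply: (@measurableI _ (g_sigma_algebraType (F (t k.+1)))); last first.
  by apply: mle; exact: mM.
apply: (@measurableI _ (g_sigma_algebraType (F (t k.+1)))).
  by apply: s2; apply: ih; exact: ltnW.
apply: mle; apply: measurable_funB; first exact: mM.
exact: (mF_sub Fle (tleS k) (mM (ltnW kN))).
Qed.

Let jump_measurable k : (k < N)%N -> <<s F (t k.+1) >> (jump k).
Proof.
move=> kN; apply: (@measurableI _ (g_sigma_algebraType (F (t k.+1)))).
  by move: (calm_measurable (ltnW kN)); apply: sub_sigma_algebra2; exact: Fle.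
apply: (@measurableC _ (g_sigma_algebraType (F (t k.+1)))).
apply: mle; apply: measurable_funB; first exact: mM.
exact: (mF_sub Fle (tleS k) (mM (ltnW kN))).
Qed.

Let subM s (A : set Om) : <<s F s >> A -> measurable A.
Proof. exact: (sub_measurable (@FM s)). Qed.

Let mcalm k : (k <= N)%N -> measurable (calm k).
Proof. by move=> /calm_measurable/subM. Qed.

Let mjump k : (k < N)%N -> measurable (jump k).
Proof. by move=> /jump_measurable/subM. Qed.

Let calmK k w : calm k w -> `|m k w| <= K.
Proof. by case: k => [_|k [_]//]; rewrite /m /t /grid_time mul0r M0 normr0. Qed.

Let f k w := cos (H w + m k w).
Let Z k w := expR (q * t k / 2) * f k w.

Let mHk k : (k <= N)%N -> mF (t k) (fun w => H w + m k w).
Proof.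
move=> kN; apply: measurable_funD; last exact: mM.
by apply: (mF_sub Fle _ mH); exact: t_ge0.
Qed.

Let mf k : (k <= N)%N -> mF (t k) (f k).
Proof.
move=> kN; apply: (measurableT_comp _ (mHk kN)).
by apply: continuous_measurable_fun; exact: continuous_cos.
Qed.

Let mmf k : (k <= N)%N -> measurable_fun [set: Om] (f k).
Proof. by move=> kN; exact: (mF_mfun FM (mf kN)). Qed.

Let f1 k w : `|f k w| <= 1.
Proof. by rewrite ler_norml cos_le1 cos_geN1. Qed.

Let int_f k : (k <= N)%N -> intg (f k).
Proof. by move=> kN; exact: (@intg_bounded _ _ _ P _ _ (mmf kN) (f1 k)). Qed.

Let im k : (k <= N)%N -> intg (m k).
Proof. by move=> kN; apply: (intg_martingale MM) => //; exact: tleT. Qed.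

Let im2 k : (k <= N)%N -> intg (fun w => m k w ^+ 2).
Proof. by move=> kN; apply: (intg_martingale2 MQ) => //; exact: tleT. Qed.

Let ind1 (A : set Om) w : `|\1_A w| <= 1 :> R.
Proof. by rewrite indicE; case: (w \in A); rewrite ?normr1 ?normr0. Qed.

Let in01 (A : set Om) w : \1_A w <= 1 :> R.
Proof. exact: (le_trans (ler_norm _) (ind1 _ _)). Qed.

Let B := expR (q * T / 2).

(** The size of the martingale just after a large increment is controlled by its
    terminal value, because [M^2] has nondecreasing expectation on events of the
    past; the terminal value does not depend on the grid. *)
Let EX_jump k : (k < N)%N ->
  EX (fun w => \1_(jump k) w * m k.+1 w ^+ 2) <=
  EX (fun w => \1_(jump k) w * M T w ^+ 2).
Proof.
move=> kN; have h := @EX_weight_increment2 _ _ _ P T F M q FS FM MQ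
  (t k.+1) T (\1_(jump k)) 1 (t_ge0 _) (tleT kN) (lexx _) _ (ind1 _).
have iT : intg (fun w => M T w ^+ 2).
  by apply: (intg_martingale2 MQ) => //; exact: ltW.
have iS := im2 kN.
rewrite -subr_ge0 -EXB; [|exact: intg_indicM (mjump kN) _..].
have -> : EX (fun w => \1_(jump k) w * M T w ^+ 2 - \1_(jump k) w * m k.+1 w ^+ 2) =
  EX (fun w => \1_(jump k) w * (M T w ^+ 2 - m k.+1 w ^+ 2 - q * (T - t k.+1)) +
               \1_(jump k) w * (q * (T - t k.+1))).
  by apply: eq_Rintegral => w _; ring.
rewrite EXD; last 2 first.
- apply: (intg_indicM (mjump kN)); apply: intgB; last exact: intg_cst.
  exact: intgB.
- by apply: (intg_indicM (mjump kN)); exact: intg_cst.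
rewrite h ?add0r; last first.
  by apply: measurable_indic; exact: jump_measurable.
apply: Rintegral_ge0 => w _; rewrite mulr_ge0// mulr_ge0// subr_ge0.
exact: tleT.
Qed.

(** Expand the cosine to second order at [m k]. The first and second order terms
    have mean zero under the weight [calm k], up to the drift of the compensator
    that the exponential factor of [Z] absorbs. The remainder is cubic in an
    increment of size at most [eps], or else quadratic on [jump k], where
    [(b - a)^2 <= 2 b^2 + 2 a^2] and [|a| <= K]. *)
Let EX_calm_increment k : (k < N)%N ->
  `|EX (fun w => \1_(calm k) w * (Z k.+1 w - Z k w))| <=
  B * ((q * del) ^+ 2 + 2 * eps * (q * del) +
       4 * EX (fun w => \1_(jump k) w * (M T w ^+ 2 + K ^+ 2))).
Proof.
move=> kN; have kN' := ltnW kN.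
have mc : mF (t k) (\1_(calm k)).
  by apply: measurable_indic; exact: calm_measurable.
have ic X : intg X -> intg (fun w => \1_(calm k) w * X w).
  exact: intg_indicM (mcalm kN').
have ij X : intg X -> intg (fun w => \1_(jump k) w * X w).
  exact: intg_indicM (mjump kN).
have iD2 : intg (fun w => D k w ^+ 2).
  have [] // := @L2B _ _ _ P (m k.+1) (m k); split.
  - exact: (mF_mfun FM (mM kN)).
  - exact: im2.
  - exact: (mF_mfun FM (mM kN')).
  - exact: im2.
have iD : intg (D k) by apply: intgB; exact: im.
pose s w := sin (H w + m k w).
have ms : mF (t k) s.
  apply: (measurableT_comp _ (mHk kN')).
  by apply: continuous_measurable_fun; exact: continuous_sin.
have s1 w : `|s w| <= 1 by rewrite ler_norml sin_le1 sin_geN1.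
have mcs : mF (t k) (fun w => \1_(calm k) w * s w) by exact: measurable_funM.
have mcf : mF (t k) (fun w => \1_(calm k) w * f k w).
  by apply: measurable_funM => //; exact: mf.
have b2 (u v : R) : `|u| <= 1 -> `|v| <= 1 -> `|u * v| <= 1.
  by move=> u1 v1; rewrite normrM mulr_ile1.
have e1 : EX (fun w => \1_(calm k) w * s w * D k w) = 0.
  apply: (EX_weight_increment FS FM MM _ _ _ mcs (B := 1)) => //.
  - exact: tleT.
  - by move=> w; exact: b2.
have calmM w : `|\1_(calm k) w * m k w| <= K.
  rewrite indicE; have [/set_mem/calmK|_] := boolP (w \in calm k).
    by rewrite mul1r.
  by rewrite mul0r normr0.
have e2 : EX (fun w => \1_(calm k) w * f k w * (D k w ^+ 2 - q * del)) = 0.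
  rewrite -(tS k); apply: (EX_weight_square FS FM Fle MM MQ _ _ _ mcf (B := 1) (B' := K)) => //.
  - exact: tleT.
  - by move=> w; exact: b2.
  - move=> w; rewrite mulrAC normrM (le_trans _ (calmM w))// ler_piMr//.
have e3 : EX (fun w => \1_(calm k) w * D k w ^+ 2) <= q * del.
  have : EX (fun w => \1_(calm k) w * (D k w ^+ 2 - q * del)) = 0.
    rewrite -(tS k); apply: (EX_weight_square FS FM Fle MM MQ _ _ _ mc (B := 1) (B' := K)) => //.
    exact: tleT.
  have -> : EX (fun w => \1_(calm k) w * (D k w ^+ 2 - q * del)) =
     EX (fun w => \1_(calm k) w * D k w ^+ 2 - \1_(calm k) w * (q * del)).
    by apply: eq_Rintegral => w _; ring.
  rewrite EXB; [|exact: ic|by apply: ic; exact: intg_cst].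
  move/eqP; rewrite subr_eq0 => /eqP ->.
  rewrite -[leRHS](EX_cst P); apply: le_EX.
  - by apply: ic; exact: intg_cst.
  - exact: intg_cst.
  - move=> w; apply: ler_piMl; first by rewrite mulr_ge0// ltW.
    exact: in01.
pose c := 1 - q * del / 2 - expR (- (q * del / 2)).
have c1 : `|c| <= (q * del) ^+ 2.
  have qd0 : 0 <= q * del by rewrite mulr_ge0// ltW.
  apply: (le_trans (@expR_gap R (q * del / 2) _)); first by rewrite divr_ge0.
  by rewrite lerXn2r// ?nnegrE ?divr_ge0//; lra.
pose r w := f k.+1 w - f k w + s w * D k w + f k w * (D k w ^+ 2 / 2).
have rE w : `|r w| <= 2 * D k w ^+ 2 /\ `|r w| <= 2 * `|D k w| ^+ 3.
  have := cos_taylor2 (H w + m k w) (D k w).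
  by rewrite /r /f /s /D (_ : H w + m k w + (m k.+1 w - m k w) = H w + m k.+1 w); last by ring.
have mr : measurable_fun [set: Om] r.
  have mD := intg_mfun iD.
  apply: measurable_funD; last by apply: measurable_funM;
    [exact: mmf|apply: measurable_funM => //; exact: measurable_funX].
  apply: measurable_funD; last by apply: measurable_funM => //; exact: (mF_mfun FM ms).
  by apply: measurable_funB; exact: mmf.
have ir : intg r.
  apply: (intg_le mr (Y := fun w => 2 * D k w ^+ 2)); last exact: intgZ.
  by move=> w; have [] := rE w.
have r_le : EX (fun w => `|\1_(calm k) w * r w|) <= 2 * eps * (q * del) +
   4 * EX (fun w => \1_(jump k) w * (M T w ^+ 2 + K ^+ 2)).
  have iT : intg (fun w => M T w ^+ 2).
    by apply: (intg_martingale2 MQ) => //; exact: ltW.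
  apply: (@le_trans _ _ (EX (fun w => 2 * eps * (\1_(calm k) w * D k w ^+ 2) +
     4 * (\1_(jump k) w * m k.+1 w ^+ 2 + \1_(jump k) w * K ^+ 2)))).
    apply: le_EX.
    - by apply/intg_norm/ic.
    - apply: intgD; first by apply/intgZ/ic.
      apply/intgZ/intgD; apply/ij; [exact: im2|exact: intg_cst].
    move=> w; rewrite !indicE; have [/set_mem cw|cw] := boolP (w \in calm k); last first.
      rewrite mul0r normr0 mul0r mulr0 add0r.
      by rewrite mulr_ge0// addr_ge0// mulr_ge0// sqr_ge0.
    rewrite !mul1r; have [r2 r3] := rE w; have [De|De] := leP `|D k w| eps.
      rewrite memNset; last by move=> [_]; exact.
      rewrite !mul0r addr0 mulr0 addr0 (le_trans r3)// -mulrA ler_pM2l//.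
      by rewrite exprSr real_normK ?num_real// mulrC ler_wpM2r// sqr_ge0.
    rewrite mem_set; last by split => //=; apply/negP; rewrite -ltNge.
    rewrite !mul1r; have := calmK cw; rewrite -[K in _ <= K]ger0_norm// => mK.
    have mK2 : m k w ^+ 2 <= K ^+ 2 by rewrite -ler_sqrt ?sqr_ge0// !sqrtr_sqr.
    have := sqr_ge0 (m k.+1 w + m k w); rewrite /D in r2 * => ?.
    have : 0 <= 2 * eps * (m k.+1 w - m k w) ^+ 2.
      by rewrite mulr_ge0 ?sqr_ge0// mulr_ge0// ltW.
    by nra.
  rewrite EXD; last 2 first.
  - by apply/intgZ/ic.
  - by apply/intgZ/intgD; apply/ij; [exact: im2|exact: intg_cst].
  rewrite EXZ; last exact: ic.
  rewrite EXZ; last by apply: intgD; apply/ij; [exact: im2|exact: intg_cst].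
  apply: lerD; first by rewrite ler_wpM2l// mulr_ge0// ltW.
  rewrite ler_pM2l// EXD; [|by apply/ij/im2|by apply/ij/intg_cst].
  have -> : EX (fun w => \1_(jump k) w * (M T w ^+ 2 + K ^+ 2)) =
    EX (fun w => \1_(jump k) w * M T w ^+ 2 + \1_(jump k) w * K ^+ 2).
    by apply: eq_Rintegral => w _; ring.
  rewrite EXD; [|exact: ij|by apply/ij/intg_cst].
  by rewrite lerD2r; exact: EX_jump.
have i1 : intg (fun w => c * (\1_(calm k) w * f k w)) by apply/intgZ/ic/int_f.
have i2 : intg (fun w => \1_(calm k) w * s w * D k w).
  under [X in EFin \o X]eq_fun do rewrite -mulrA.
  apply: ic; apply: (intg_le _ _ (intg_norm iD)).
    by apply: measurable_funM; [exact: (mF_mfun FM ms)|exact: intg_mfun iD].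
  by move=> w; rewrite normrM ler_piMl.
have i3' : intg (fun w => \1_(calm k) w * f k w * (D k w ^+ 2 - q * del)).
  under [X in EFin \o X]eq_fun do rewrite -mulrA.
  apply: ic; apply: (intg_le _ _ (intg_norm (intgB iD2 (intg_cst P (q * del))))).
    apply: measurable_funM; first exact: mmf.
    apply: measurable_funB => //; apply: measurable_funX; exact: intg_mfun iD.
  by move=> w; rewrite normrM ler_piMl.
have i3 := intgZ 2^-1 i3'; have i4 := ic _ ir; have i12 := intgB i1 i2; have i123 := intgB i12 i3.
have -> : EX (fun w => \1_(calm k) w * (Z k.+1 w - Z k w)) =
   expR (q * t k.+1 / 2) * EX (fun w => c * (\1_(calm k) w * f k w) -
      \1_(calm k) w * s w * D k w -
      2^-1 * (\1_(calm k) w * f k w * (D k w ^+ 2 - q * del)) + \1_(calm k) w * r w).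
  rewrite -EXZ; last exact: intgD.
  apply: eq_Rintegral => w _; rewrite /Z /r /c.
  have -> : expR (q * t k / 2) = expR (q * t k.+1 / 2) * expR (- (q * del / 2)).
    by rewrite -expRD; congr expR; rewrite -(tS k); ring.
  by field.
rewrite normrM ger0_norm ?expR_ge0// ler_pM ?expR_ge0//.
  by rewrite /B ler_expR ler_pM2r// ler_wpM2l// tleT.
rewrite EXD// EXB// EXB// e1 subr0 (EXZ 2^-1 i3').
rewrite e2 mulr0 subr0 (le_trans (ler_normD _ _))// -addrA lerD//; last first.
  by apply: (le_trans _ r_le); apply: le_norm_EX => //; exact: intg_norm.
apply: (@le_trans _ _ (EX (fun w => (q * del) ^+ 2))); last by rewrite EX_cst.
apply: le_norm_EX => //; first exact: intg_cst.
move=> w; rewrite normrM (le_trans _ c1)// ler_piMr//.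
by apply: b2.
Qed.

(** There is at most one large increment, since the grid is abandoned after it. *)
Let sum_jump w : \sum_(k < N) \1_(jump k) w <= \1_osc w :> R.
Proof.
rewrite [leRHS]indicE; have [_|wo] := boolP (w \in osc); last first.
  rewrite big1// => k _; rewrite indicE memNset// => -[_ Dk].
  by move/negP : wo; apply; rewrite inE; exists k => //=; exact: ltn_ord.
suff h l : \sum_(k < l) \1_(jump k) w <= 1 - \1_(calm l) w :> R.
  by apply: (le_trans (h N)); rewrite lerBlDr lerDl.
elim: l => [|l ih]; first by rewrite big_ord0 subr_ge0.
rewrite big_ord_recr/=; apply: (le_trans (lerD ih (lexx _))).
suff : \1_(jump l) w + \1_(calm l.+1) w <= \1_(calm l) w :> R by move=> /=; lra.
rewrite !indicE; have [/set_mem wc|wc] := boolP (w \in calm l).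
  have [/set_mem[_ wj]|_] := boolP (w \in jump l).
    by rewrite memNset ?addr0// => -[[]].
  by rewrite add0r; case: (_ \in _).
rewrite memNset; last by move=> [/mem_set]; rewrite (negPf wc).
by rewrite memNset ?addr0// => -[[/mem_set]]; rewrite (negPf wc).
Qed.

Let ZB k w : (k <= N)%N -> `|Z k w| <= B.
Proof.
move=> kN; rewrite /Z normrM ger0_norm ?expR_ge0// -[B]mulr1 ler_pM ?expR_ge0//.
by rewrite /B ler_expR ler_pM2r// ler_wpM2l// tleT.
Qed.

(** The weighted increments telescope up to the index at which the grid is
    abandoned. *)
Let stopped_sum w l : (l <= N)%N -> exists j, [/\ (j <= N)%N,
  \sum_(k < l) \1_(calm k) w * (Z k.+1 w - Z k w) = Z j w - Z 0 w &
  calm l w -> j = l].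
Proof.
elim: l => [_|l ih lN]; first by exists 0%N; rewrite big_ord0 subrr.
have [j [jN E jl]] := ih (ltnW lN); rewrite big_ord_recr/= E indicE.
have [/set_mem wc|wc] := boolP (w \in calm l).
  by exists l.+1; split => //; rewrite (jl wc) mul1r addrC subrKA.
exists j; split => //; first by rewrite mul0r addr0.
by move=> [[/mem_set]]; rewrite (negPf wc).
Qed.

Let not_calm w : ~ calm N w -> osc w \/ exceeds K w.
Proof.
move=> nc; apply: contrapT => /not_orP[no ne]; apply: nc.
elim: {-2}N (leqnn N) => [//|l ih lN] /=; split; first split.
- exact/ih/ltnW.
- by apply: contrapT => h; apply: no; exists l.
- by apply: contrapT => h; apply: ne; exists n => //; exists l.+1.
Qed.

(** The telescoping sum of the increments of [Z] along the grid, compared with the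
    weighted sum; they differ only on the event that the grid is abandoned, where
    both are bounded. *)
Lemma grid_bound :
  `|EX (fun w => expR (q * T / 2) * cos (H w + M T w)) - EX (fun w => cos (H w))| <=
  expR (q * T / 2) * ((q * T) ^+ 2 / n.+1%:R + 2 * eps * (q * T) +
    4 * EX (fun w => \1_(oscillates n eps) w * (M T w ^+ 2 + K ^+ 2)) +
    2 * (EX (fun w => \1_(oscillates n eps) w * 1) +
         EX (fun w => \1_(exceeds K) w * 1))).
Proof.
have N0 : (n.+1%:R : R) != 0 by rewrite pnatr_eq0.
have mosc := measurable_oscillates n eps; have mexc := measurable_exceeds K.
have iT : intg (fun w => M T w ^+ 2).
  by apply: (intg_martingale2 MQ) => //; exact: ltW.
have iTK : intg (fun w => M T w ^+ 2 + K ^+ 2) by apply: intgD => //; exact: intg_cst.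
have iZ k : (k <= N)%N -> intg (Z k) by move=> kN; apply/intgZ/int_f.
pose X (k : 'I_N) w := \1_(calm k) w * (Z k.+1 w - Z k w).
have iX k : intg (X k).
  apply: intg_indicM; first by apply: mcalm; exact/ltnW/ltn_ord.
  by apply: intgB; apply: iZ => //; exact/ltnW/ltn_ord.
have iS : intg (fun w => \sum_k X k w) by exact: intg_sum.
have io Y : intg Y -> intg (fun w => \1_(oscillates n eps) w * Y w) by exact: intg_indicM.
have i1 : intg (fun w => \1_(oscillates n eps) w * 1) by apply: io; exact: intg_cst.
have i2 : intg (fun w => \1_(exceeds K) w * 1).
  by apply: intg_indicM => //; exact: intg_cst.
have -> : EX (fun w => expR (q * T / 2) * cos (H w + M T w)) - EX (fun w => cos (H w)) =
    EX (fun w => Z N w - Z 0 w).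
  rewrite EXB ?iZ//; congr (_ - _); apply: eq_Rintegral => w _.
    by rewrite /Z /f /m tN.
  by rewrite /Z /f /m /t /grid_time mul0r mulr0 mul0r expR0 mul1r M0 addr0.
have -> : EX (fun w => Z N w - Z 0 w) =
    EX (fun w => (Z N w - Z 0 w - \sum_k X k w) + \sum_k X k w).
  by apply: eq_Rintegral => w _; rewrite subrK.
rewrite EXD//; last by apply: intgB => //; apply: intgB; exact: iZ.
rewrite (le_trans (ler_normD _ _))// addrC mulrDr lerD//.
  rewrite EX_sum// (le_trans (ler_norm_sum _ _ _))//.
  apply: (@le_trans _ _ (\sum_(k < N) B * ((q * del) ^+ 2 + 2 * eps * (q * del) +
       4 * EX (fun w => \1_(jump k) w * (M T w ^+ 2 + K ^+ 2))))).
    by apply: ler_sum => k _; exact: EX_calm_increment.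
  rewrite -mulr_sumr /B ler_wpM2l ?expR_ge0// !big_split/= !sumr_const card_ord.
  rewrite -mulr_sumr; apply: lerD; first apply: lerD.
  - rewrite -mulr_natl /del /N le_eqVlt; apply/orP; left; apply/eqP.
    by have := N0; generalize (n.+1%:R : R) => x x0; field.
  - rewrite -mulr_natl /del /N le_eqVlt; apply/orP; left; apply/eqP.
    by have := N0; generalize (n.+1%:R : R) => x x0; field.
  rewrite ler_pM2l// -(@EX_sum _ _ _ P _ _ (fun (k : 'I_N) w => \1_(jump k) w * (M T w ^+ 2 + K ^+ 2))).
    apply: le_EX; last first.
    - move=> w; rewrite -mulr_suml; apply: ler_wpM2r; last exact: sum_jump.
      by rewrite addr_ge0// sqr_ge0.
    - exact: io.
    - by apply: intg_sum => k; apply: intg_indicM => //; apply: mjump.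
  by move=> k; apply: intg_indicM => //; apply: mjump.
rewrite -EXD// mulrA -EXZ; last exact: intgD.
apply: le_norm_EX.
- by apply: intgB => //; apply: intgB; exact: iZ.
- by apply: intgZ; exact: intgD.
move=> w; have [j [jN -> jl]] := stopped_sum w (leqnn N).
rewrite !mulr1; have [/jl ->|/not_calm h] := pselect (calm N w).
  by rewrite subrr normr0 mulr_ge0 ?addr_ge0// mulr_ge0// expR_ge0.
have -> : Z N w - Z 0 w - (Z j w - Z 0 w) = Z N w - Z j w by ring.
rewrite (le_trans (ler_normB _ _))//.
apply: (@le_trans _ _ (B + B)); first by rewrite lerD// ZB.
rewrite -/B -[leLHS]mulr1 (_ : B + B = B * 2); last by ring.
rewrite ler_pM2l ?mulr_gt0// ?expR_gt0//.
rewrite !indicE; case: h => h; first by rewrite mem_set// lerDl.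
by rewrite (mem_set h) lerDr.
Qed.

End grid.

(** A continuous path on a segment is uniformly continuous. *)
Let grid_cvg_osc eps Y : 0 < eps -> intg Y ->
  EX (fun w => \1_(oscillates n eps) w * Y w) @[n --> \oo] --> 0.
Proof.
move=> eps0 iY; apply: EX_vanishing_sets => //.
  by move=> n; exact: measurable_oscillates.
apply: filterS cM => w cw; have [del del0 Hd] := heine cw eps0.
have [n0 _ Hn] := @near_infty_natSinv_lt R (PosNum (divr_gt0 del0 T0)).
exists n0 => // n /Hn /= nd [k /= kn]; apply.
apply/ltW/Hd; rewrite ?in_itv/= ?grid_time_ge0 ?grid_time_le//; first exact: ltnW.
by rewrite grid_timeS gtr0_norm ?divr_gt0// -ltr_pdivlMl// mulrC.
Qed.

(** A continuous path on a segment is bounded. *)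
Let cvg_exceeds : EX (fun w => \1_(exceeds n%:R) w * 1) @[n --> \oo] --> 0.
Proof.
apply: EX_vanishing_sets => //; first exact: intg_cst.
  by move=> n; exact: measurable_exceeds.
apply: filterS cM => w cw; have [K HK] := within_continuous_bounded cw.
have [n0 _ Hn] := @nbhs_infty_ger R K.
exists n0 => // n /Hn /= nd [l _ [k /= kl]]; apply.
by apply: (le_trans _ nd); apply: HK; rewrite in_itv/= grid_time_ge0 grid_time_le.
Qed.

(** Given the past, [M T] is centered Gaussian of variance [q T]: the process
    [expR (q t / 2) * cos (H + M t)] has constant expectation. In [grid_bound] the
    mesh goes to zero first, then the level [K] to infinity, then the size [eps]
    of the admissible increments to zero. *)
Lemma levy : EX (fun w => cos (H w + M T w)) =
  expR (- (q * T / 2)) * EX (fun w => cos (H w)).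
Proof.
pose B := expR (q * T / 2).
have B0 : 0 < B by exact: expR_gt0.
have iT : intg (fun w => M T w ^+ 2).
  by apply: (intg_martingale2 MQ) => //; exact: ltW.
have icos : intg (fun w => cos (H w + M T w)).
  apply: (@intg_bounded _ _ _ P _ 1); last by move=> w; rewrite ler_norml cos_le1 cos_geN1.
  apply: measurableT_comp; first by apply: continuous_measurable_fun; exact: continuous_cos.
  apply: measurable_funD; first exact: (mF_mfun FM mH).
  exact: (mF_mfun FM (mF_martingale Fle MM (ltW T0) (lexx _) (lexx _))).
suff : `|B * EX (fun w => cos (H w + M T w)) - EX (fun w => cos (H w))| <= 0.
  rewrite normr_le0 subr_eq0 => /eqP <-.
  by rewrite mulrA expRN mulVf ?mul1r// gt_eqF.
rewrite -EXZ//; set a := `|_|.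
suff h eps : 0 < eps -> a <= B * (2 * eps * (q * T)).
  apply/ler_addgt0Pr => e e0; rewrite add0r.
  have C0 : 0 < B * (2 * (q * T + 1)).
    by rewrite !mulr_gt0// ltr_wpDl// mulr_ge0// ltW.
  apply: (le_trans (h (e / (B * (2 * (q * T + 1)))) _)); first by rewrite divr_gt0.
  have -> : B * (2 * (e / (B * (2 * (q * T + 1)))) * (q * T)) = e * (q * T / (q * T + 1)).
    have aux (b c x : R) : 0 < b -> 0 < c ->
        b * (2 * (e / (b * (2 * c))) * x) = e * (x / c).
      by move=> b0 c0; field; rewrite ?gt_eqF.
    by apply: aux => //; rewrite ltr_wpDl// mulr_ge0// ltW.
  rewrite ler_piMr ?(ltW e0)// ler_pdivrMr ?mul1r ?lerDl//.
  by rewrite ltr_wpDl// mulr_ge0// ltW.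
move=> eps0.
suff h (K : R) : 0 <= K -> a <= B * (2 * eps * (q * T) + 2 * EX (fun w => \1_(exceeds K) w * 1)).
  have c : B * (2 * eps * (q * T) + 2 * EX (fun w => \1_(exceeds n%:R) w * 1))
      @[n --> \oo] --> B * (2 * eps * (q * T) + 2 * 0).
    apply: cvgMr; apply: cvgD; first exact: cvg_cst.
    by apply: cvgMr; exact: cvg_exceeds.
  rewrite mulr0 addr0 in c.
  by apply: (cvgr_to_ge c); apply: nearW => n; exact: h.
move=> K0.
have c : B * ((q * T) ^+ 2 / n.+1%:R + 2 * eps * (q * T) +
    4 * EX (fun w => \1_(oscillates n eps) w * (M T w ^+ 2 + K ^+ 2)) +
    2 * (EX (fun w => \1_(oscillates n eps) w * 1) + EX (fun w => \1_(exceeds K) w * 1)))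
   @[n --> \oo] --> B * ((q * T) ^+ 2 * 0 + 2 * eps * (q * T) + 4 * 0 +
     2 * (0 + EX (fun w => \1_(exceeds K) w * 1))).
  apply: cvgMr; apply: cvgD; last first.
    apply: cvgMr; apply: cvgD; last exact: cvg_cst.
    by apply: grid_cvg_osc => //; exact: intg_cst.
  apply: cvgD; last first.
    apply: cvgMr; apply: (@grid_cvg_osc eps (fun w => M T w ^+ 2 + K ^+ 2)) => //.
    by apply: intgD => //; exact: intg_cst.
  apply: cvgD; last exact: cvg_cst.
  by apply: cvgMr; exact: cvg_harmonic.
rewrite !mulr0 add0r addr0 add0r in c.
by apply: (cvgr_to_ge c); apply: nearW => n; exact: grid_bound.
Qed.

End levy.

(** * Time integrals of continuous processes *)

Section riemann.
Context (R : realType).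
Notation leb := (@lebesgue_measure R).

Lemma riemann_sum_cvg (t : R) (g : R -> R) : 0 < t ->
  {within `[0, t], continuous g} ->
  t / n.+1%:R * (\sum_(k < n.+1) g (grid_time t n k)) @[n --> \oo]
    --> \int[leb]_(s in `[0, t]) g s.
Proof.
move=> t0 cg; apply/cvgrPdist_le => e e0.
have ig : leb.-integrable `[0, t] (EFin \o g).
  by apply: continuous_compact_integrable => //; exact: segment_compact.
have et0 : 0 < e / t by rewrite divr_gt0.
have [del del0 Hd] := heine cg et0.
have [n0 _ Hn] := @near_infty_natSinv_lt R (PosNum (divr_gt0 del0 t0)).
exists n0 => // n /Hn /= nd.
have h0 : 0 < t / n.+1%:R by rewrite divr_gt0.
have hd : t / n.+1%:R < del by rewrite -ltr_pdivlMl// mulrC.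
pose u k := grid_time t n k.
have u0 k : 0 <= u k by exact: grid_time_ge0.
have uS k : u k.+1 - u k = t / n.+1%:R by exact: grid_timeS.
have uT k : (k <= n.+1)%N -> u k <= t by exact: grid_time_le.
pose G k := \int[leb]_(s in `[0, u k]) g s.
have step k : (k < n.+1)%N ->
    `|G k.+1 - G k - t / n.+1%:R * g (u k)| <= e / t * (t / n.+1%:R).
  move=> kn.
  have uk : u k <= u k.+1 by rewrite -subr_ge0 uS ltW.
  have sub (a b : itv_bound R) : (BLeft 0 <= a)%O -> (b <= BRight t)%O ->
      leb.-integrable [set` Interval a b] (EFin \o g).
    move=> a0 bt; apply: integrableS ig => //.
    exact: subset_itv.
  rewrite /G (@Rintegral_itvB _ g (BLeft 0) (BRight (u k.+1)) (u k)); last 3 first.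
  - by apply: sub => //; rewrite bnd_simp uT.
  - by rewrite bnd_simp.
  - by rewrite bnd_simp.
  have lenE : leb `]u k, u k.+1] = (t / n.+1%:R)%:E.
    by rewrite lebesgue_measure_itv/= lte_fin -subr_gt0 uS h0 -EFinD uS.
  have iI : leb.-integrable `]u k, u k.+1] (EFin \o g).
    by apply: sub; rewrite bnd_simp// uT.
  have iC c : leb.-integrable `]u k, u k.+1] (EFin \o (fun=> c)).
    apply: (@measurable_bounded_integrable _ _ _ leb) => //.
      exact: (@eq_ind_r _ _ (fun x : \bar R => (x < +oo)%E) (ltry _) _ lenE).
    by exists `|c|; split => // M /ltW cM x _ /=; rewrite (le_trans _ cM)// normr_id.
  have -> : t / n.+1%:R * g (u k) = \int[leb]_(s in `]u k, u k.+1]) g (u k).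
    by rewrite Rintegral_cst// mulrC; congr (_ * _); exact/esym/(congr1 fine lenE).
  rewrite -RintegralB//.
  apply: (le_trans (le_normr_Rintegral _ _)) => //.
    exact: (integrableB _ iI (iC (g (u k)))).
  have -> : e / t * (t / n.+1%:R) = \int[leb]_(s in `]u k, u k.+1]) (e / t).
    by rewrite Rintegral_cst//; congr (_ * _); exact/esym/(congr1 fine lenE).
  apply: le_Rintegral => //.
    by apply: integrable_norm; exact: (integrableB _ iI (iC (g (u k)))).
  move=> x /=; rewrite in_itv/= => /andP[ux xu].
  apply/ltW/Hd; rewrite ?in_itv/= ?u0 ?uT//; [|exact: ltnW|].
    by rewrite (le_trans (u0 k) (ltW ux)) (le_trans xu)// uT.
  rewrite gtr0_norm ?subr_gt0// (le_lt_trans _ hd)// -(uS k).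
  by rewrite lerD2r.
have E l : \int[leb]_(s in `[0, u l]) g s = \sum_(k < l) (G k.+1 - G k).
  elim: l => [|l ih]; last by rewrite big_ord_recr/= -ih addrC subrK.
  by rewrite big_ord0 /u /grid_time mul0r set_itv1 Rintegral_set1.
rewrite -[t in X in `|X - _|](grid_time_last t n) (E n.+1) mulr_sumr -sumrB.
rewrite (le_trans (ler_norm_sum _ _ _))//.
apply: (@le_trans _ _ (\sum_(k < n.+1) (e / t * (t / n.+1%:R)))).
  by apply: ler_sum => k _; exact: step.
rewrite sumr_const card_ord -(mulr_natl (e / t * _)) le_eqVlt; apply/orP; left; apply/eqP.
have N0 : (n.+1%:R : R) != 0 by rewrite pnatr_eq0.
have t1 : t != 0 by rewrite gt_eqF.
by rewrite mulrCA [_ * (t / _)]mulrCA divff ?mulr1 ?divfK.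
Qed.

End riemann.

Section L2_bounds.
Context d (Om : measurableType d) (R : realType) (P : probability Om R).
Implicit Types X Y : Om -> R.

Local Notation mfun X := (measurable_fun [set: Om] X).
Local Notation intg X := (P.-integrable [set: Om] (EFin \o X)).
Local Notation EX X := (\int[P]_w X w).

Definition L2le X (m : R) := L2 P X /\ EX (fun w => X w ^+ 2) <= m.

Lemma L2le_ereal X m : mfun X -> (\int[P]_w ((X w) ^+ 2)%:E <= m%:E)%E ->
  L2le X m.
Proof. by move=> mX /(L2P mX). Qed.

Lemma L2leP X m : L2le X m -> (\int[P]_w ((X w) ^+ 2)%:E <= m%:E)%E.
Proof.
move=> [[_ iX]]; rewrite /Rintegral -lee_fin fineK//.
exact: (integrable_fin_num measurableT iX).
Qed.

Lemma L2le_weak X m m' : L2le X m -> m <= m' -> L2le X m'.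
Proof. by move=> [LX Xm] mm'; split => //; exact: le_trans mm'. Qed.

Lemma L2le_norm1 X m : 0 <= m -> L2le X (m ^+ 2) -> EX (fun w => `|X w|) <= m.
Proof. by move=> m0 [LX Xm]; exact: L2_norm1. Qed.

Lemma L2leD X Y a b : L2le X a -> L2le Y b ->
  L2le (fun w => X w + Y w) (2 * a + 2 * b).
Proof.
move=> [LX Xa] [LY Yb]; split; first exact: L2D.
have [_ iX] := LX; have [_ iY] := LY; have [_ iXY] := L2D LX LY.
apply: (@le_trans _ _ (EX (fun w => 2 * X w ^+ 2 + 2 * Y w ^+ 2))).
  apply: le_EX => //; first by apply: intgD; exact: intgZ.
  by move=> w; have := sqr_ge0 (X w - Y w); nra.
by rewrite EXD ?EXZ//; [lra|exact: intgZ..].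
Qed.

(** Cauchy-Schwarz for signed weights: summing [2 y z <= z^2 + y^2] gives an
    inequality quadratic in [y], which is optimal at [y = S / A]. *)
Lemma sqr_weighted_sum (J : Type) (s : seq (R * J)) (z : J -> R) :
  (\sum_(p <- s) p.1 * z p.2) ^+ 2 <=
  (\sum_(p <- s) `|p.1|) * (\sum_(p <- s) `|p.1| * z p.2 ^+ 2).
Proof.
set S := \sum_(p <- s) p.1 * z p.2; set A := \sum_(p <- s) `|p.1|.
set Q := (X in _ <= _ * X).
have A0 : 0 <= A by exact: sumr_ge0.
have h y : 2 * y * S <= Q + A * y ^+ 2.
  rewrite /S /Q /A mulr_sumr mulr_suml -big_split/=; apply: ler_sum => -[a j] _ /=.
  have h1 := ler_norm (a * (y * z j)); rewrite normrM in h1.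
  have h2 : 2 * `|y * z j| <= z j ^+ 2 + y ^+ 2.
    rewrite normrM -(real_normK (num_real (z j))) -(real_normK (num_real y)).
    by have := sqr_ge0 (`|y| - `|z j|); nra.
  have := ler_wpM2l (normr_ge0 a) h2; rewrite !mulrDr.
  by move: h1; set n := `|y * z j|; nra.
move: A0; rewrite le_eqVlt => /predU1P[A0|A0].
  rewrite -A0 mul0r; have [->|S0] := eqVneq S 0; first by rewrite expr0n.
  have := h ((Q + 1) / (2 * S)); rewrite -A0 mul0r addr0.
  have -> : 2 * ((Q + 1) / (2 * S)) * S = Q + 1 by field.
  by lra.
have := h (S / A).
have -> : 2 * (S / A) * S = 2 * (S ^+ 2 / A) by field; rewrite gt_eqF.
have -> : A * (S / A) ^+ 2 = S ^+ 2 / A by field; rewrite gt_eqF.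
move=> h2; have : S ^+ 2 / A <= Q by lra.
by rewrite ler_pdivrMr// mulrC.
Qed.

Lemma L2le_weighted_sum (J : Type) (s : seq (R * J)) (Z : J -> Om -> R) m :
  (forall j, L2le (Z j) m) ->
  L2le (fun w => \sum_(p <- s) p.1 * Z p.2 w) ((\sum_(p <- s) `|p.1|) ^+ 2 * m).
Proof.
move=> LZ; set A := \sum_(p <- s) `|p.1|.
have L : L2 P (fun w => \sum_(p <- s) p.1 * Z p.2 w).
  by apply: L2_sum => p; apply: L2Z; have [] := LZ p.2.
split => //; have [_ iS] := L.
have iZ j : intg (fun w => Z j w ^+ 2) by have [[]] := LZ j.
apply: (@le_trans _ _ (EX (fun w => A * \sum_(p <- s) `|p.1| * Z p.2 w ^+ 2))).
  apply: le_EX => //.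
    by apply: intgZ; apply: intg_sum => p; exact: intgZ.
  by move=> w; exact: (sqr_weighted_sum s (Z ^~ w)).
rewrite EXZ; last by apply: intg_sum => p; exact: intgZ.
rewrite expr2 -mulrA ler_wpM2l//; first exact: sumr_ge0.
rewrite EX_sum; last by move=> p; exact: intgZ.
rewrite /A mulr_suml; apply: ler_sum => p _.
by rewrite EXZ// ler_wpM2l//; have [] := LZ p.2.
Qed.

(** Fatou's lemma for the Riemann sums of the paths: the second moment of a Riemann
    sum is bounded by convexity, for each grid, and the continuity of the paths
    takes the place of joint measurability. *)
Lemma L2le_time_integral (xi : R -> Om -> R) (t m : R) : 0 < t ->
  (forall w, {within `[0, t], continuous (xi ^~ w)}) ->
  (forall s, 0 <= s <= t -> L2le (xi s) m) ->
  L2le (fun w => \int[lebesgue_measure]_(s in `[0, t]) xi s w) (t ^+ 2 * m).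
Proof.
move=> t0 cxi Lxi.
pose S n w := t / n.+1%:R * (\sum_(k < n.+1) xi (grid_time t n k) w).
have cS w : S n w @[n --> \oo] --> \int[lebesgue_measure]_(s in `[0, t]) xi s w.
  exact: (riemann_sum_cvg t0 (cxi w)).
have LS n : L2le (S n) (t ^+ 2 * m).
  have := @L2le_weighted_sum _ [seq (t / n.+1%:R, k) | k <- index_enum 'I_n.+1]
    (fun k : 'I_n.+1 => xi (grid_time t n k)) m.
  move=> /(_ _)[k|].
    apply: Lxi; rewrite grid_time_ge0// grid_time_le//.
    exact/ltnW/ltn_ord.
  rewrite big_map/= sumr_const card_ord ger0_norm ?divr_ge0 ?(ltW t0)//.
  rewrite -[X in X ^+ 2]mulr_natl mulrCA divff ?pnatr_eq0// mulr1 => L Lm.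
  have E : S n = (fun w => \sum_(p <- [seq (t / n.+1%:R, k) | k <- index_enum 'I_n.+1])
       p.1 * xi (grid_time t n p.2) w).
    by apply/funext => w; rewrite /S mulr_sumr big_map.
  by rewrite E.
apply: L2le_ereal.
  apply: (@measurable_fun_cvg _ _ _ _ S) => [n|w _]; last exact: cS.
  by have [[]] := LS n.
have E w : ((\int[lebesgue_measure]_(s in `[0, t]) xi s w) ^+ 2)%:E =
    limn_einf (fun n => ((S n w) ^+ 2)%:E).
  apply/esym/(fun c => (cvg_limn_einf_sup c).1).
  apply: cvg_EFin; first exact: nearW.
  by under eq_fun do rewrite expr2; rewrite expr2; exact: cvgM.
under eq_integral do rewrite E.
apply: (le_trans (@fatou _ _ _ P setT measurableT (fun n w => ((S n w) ^+ 2)%:E) _ _)).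
- move=> n; apply/measurable_EFinP/measurable_funX.
  by have [[]] := LS n.
- by move=> n w _; rewrite lee_fin sqr_ge0.
rewrite limn_einf_lim; apply: lime_le; first exact: is_cvg_einfs.
apply: nearW => n; apply: (le_trans _ (L2leP (LS n))).
by apply: ereal_inf_lbound; exists n => /=.
Qed.

End L2_bounds.

(** * Finitely supported functionals *)

Section functionals.
Context (R : realType) (I : choiceType).
Implicit Types (s : seq (R * I)) (v : I -> R).

(** A finitely supported functional is a list of weighted sites, in which a site
    may be repeated; concatenation and scaling of lists replace the arithmetic of
    functions on sites, and [nrm] is an upper bound of the l^1 norm that is additive
    by construction. *)
Definition lin s v : R := \sum_(p <- s) p.1 * v p.2.
Definition nrm s : R := \sum_(p <- s) `|p.1|.
Definition coeff s (x : I) : R := \sum_(p <- s | p.2 == x) p.1.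
Definition scale (a : R) s := [seq (a * p.1, p.2) | p <- s].

Lemma lin_cons p s v : lin (p :: s) v = p.1 * v p.2 + lin s v.
Proof. by rewrite /lin big_cons. Qed.

Lemma lin_cat s s' v : lin (s ++ s') v = lin s v + lin s' v.
Proof. by rewrite /lin big_cat. Qed.

Lemma lin_scale a s v : lin (scale a s) v = a * lin s v.
Proof. by rewrite /lin big_map mulr_sumr; apply: eq_bigr => p _; rewrite mulrA. Qed.

Lemma nrm_ge0 s : 0 <= nrm s.
Proof. exact: sumr_ge0. Qed.

Lemma nrm_cat s s' : nrm (s ++ s') = nrm s + nrm s'.
Proof. by rewrite /nrm big_cat. Qed.

Lemma nrm_cons p s : nrm (p :: s) = `|p.1| + nrm s.
Proof. by rewrite /nrm big_cons. Qed.

Lemma nrm_scale a s : nrm (scale a s) = `|a| * nrm s.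
Proof. by rewrite /nrm big_map mulr_sumr; apply: eq_bigr => p _; rewrite normrM. Qed.

Lemma coeff_support s : [set x | coeff s x != 0] `<=` [set` map snd s].
Proof.
move=> x /=; apply: contra_neqT => xs; rewrite /coeff big_seq_cond big1// => p.
by case/andP=> ps /eqP px; move: xs; rewrite -px map_f.
Qed.

Lemma coeff_finite s : finite_set [set x | coeff s x != 0].
Proof. exact: (sub_finite_set (@coeff_support s)). Qed.

Lemma pairing_coeff s v : pairing v (coeff s) = lin s v.
Proof.
pose r := undup (map snd s).
have sr p : p \in s -> p.2 \in r by move=> ps; rewrite mem_undup map_f.
have Z x : x \notin r -> coeff s x = 0.
  move=> xs; rewrite /coeff big_seq_cond big1// => p /andP[/sr ps /eqP px].
  by move: xs; rewrite -px ps.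
rewrite /pairing (@fsbigE _ _ _ _ _ r) ?undup_uniq//; last first.
  by move=> x _ /Z ->; rewrite mulr0.
rewrite (eq_bigl xpredT); last by move=> x; exact: mem_set.
under eq_bigr do rewrite /coeff mulr_sumr.
rewrite (exchange_big_dep xpredT)//= /lin big_seq [RHS]big_seq.
apply: eq_bigr => p /sr ps.
rewrite (eq_bigl (pred1 p.2)); last first.
  by move=> x /=; rewrite (eq_sym p.2).
rewrite big_mkcond (bigD1_seq p.2) ?undup_uniq//= eqxx big1 ?addr0 1?mulrC//.
by move=> x /negPf ->.
Qed.

(** The growth rate of the quadratic variation of the martingale attached to [s]. *)
Definition rate s : R := \sum_(x \in [set: I]) coeff s x ^+ 2.

Lemma rate_ge0 s : 0 <= rate s.
Proof.
have -> : rate s = \sum_(x \in [set: I]) `|coeff s x ^+ 2|.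
  by apply: eq_fsbigr => x _; rewrite ger0_norm// sqr_ge0.
by apply: sumr_ge0.
Qed.

End functionals.

(** * Continuity and measurability of the functionals *)

Section continuous_functions.
Context (R : realType) (V : normedModType R).

Lemma lipschitz_continuous (f : V -> R) (K : R) :
  (forall u v, `|f u - f v| <= K * `|u - v|) -> continuous f.
Proof.
move=> fK v; apply/cvgrPdist_lt => e e0.
have K0 : 0 < `|K| + 1 by rewrite ltr_wpDl.
apply/nbhs_ballP; exists (e / (`|K| + 1)) => /=; first by rewrite divr_gt0.
move=> u; rewrite -ball_normE/= ltr_pdivlMr// => uv.
apply: le_lt_trans uv; apply: (le_trans (fK v u)).
rewrite mulrC ler_wpM2l//; have := ler_norm K; lra.
Qed.

Lemma measurable_continuous (f : V -> R) : continuous f ->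
  measurable_fun [set: borel V] (f : borel V -> R).
Proof.
move=> /continuousP cf; apply: (measurability _ (RGenOpens.measurableE R)).
move=> _ [_ [a [b ->] <-]]; rewrite setTI; apply: sub_sigma_algebra.
exact/cf/interval_open.
Qed.

End continuous_functions.

Section state_space.
Context (R : realType) (I : choiceType) (c : I -> {posnum R}).
Local Notation E := (ell2 c).

Lemma le_coord (v : E) x : (c x)%:num * v x ^+ 2 <= `|v| ^+ 2.
Proof.
rewrite -lee_fin [X in (_ <= X)%E](ell2_norm_sqr v).
rewrite -[leLHS](@esum_set1 _ _ x (fun x => ((c x)%:num * v x ^+ 2)%:E)).
  rewrite /enorm2 [leRHS](esumID [set x])//; last first.
    by move=> *; exact: enorm2_term_ge0.
  by rewrite setTI leeDl// esum_ge0// => *; exact: enorm2_term_ge0.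
exact: enorm2_term_ge0.
Qed.

Lemma coord_lipschitz x (u v : E) :
  `|u x - v x| <= (Num.sqrt (c x)%:num)^-1 * `|u - v|.
Proof.
have c0 : 0 < Num.sqrt (c x)%:num by rewrite sqrtr_gt0.
rewrite ler_pdivlMl// -ler_sqr ?nnegrE ?mulr_ge0 ?sqrtr_ge0// exprMn.
by rewrite sqr_sqrtr// real_normK ?num_real//; exact: (le_coord (u - v)).
Qed.

Lemma coord_continuous x : continuous (fun v : E => v x).
Proof. exact: (@lipschitz_continuous _ E _ _ (@coord_lipschitz x)). Qed.

Lemma measurable_coord x : measurable_fun [set: borel E] (fun v : borel E => (v : E) x).
Proof. by apply: measurable_continuous; exact: coord_continuous. Qed.

Lemma lin_continuous s : continuous (fun v : E => lin s v).
Proof.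
suff [K HK] : exists K, forall u v : E, `|lin s u - lin s v| <= K * `|u - v|.
  exact: (@lipschitz_continuous _ E _ K HK).
elim: s => [|p s [K HK]]; first by exists 0 => u v; rewrite /lin !big_nil subrr normr0 mul0r.
exists (`|p.1| * (Num.sqrt (c p.2)%:num)^-1 + K) => u v; rewrite !lin_cons.
have -> : p.1 * u p.2 + lin s u - (p.1 * v p.2 + lin s v) =
  p.1 * (u p.2 - v p.2) + (lin s u - lin s v) by ring.
rewrite (le_trans (ler_normD _ _))// mulrDl lerD// normrM -mulrA.
by rewrite ler_wpM2l//; exact: coord_lipschitz.
Qed.

Lemma measurable_lin s : measurable_fun [set: borel E] (fun v : borel E => lin s (v : E)).
Proof. by apply: measurable_continuous; exact: lin_continuous. Qed.

End state_space.

(** * Second moments of a martingale *)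

Lemma sumr_seq_cst (R : realType) (J : Type) (r : seq J) (a : R) :
  \sum_(j <- r) a = a * (size r)%:R.
Proof.
elim: r => [|j r ih]; first by rewrite big_nil mulr0.
by rewrite big_cons ih /= -natr1 mulrDr mulr1 addrC.
Qed.

Section L2_weight.
Context d (Om : measurableType d) (R : realType) (P : probability Om R).
Variables (T : R) (F : R -> set (set Om)) (M : R -> Om -> R) (q : R).
Hypothesis T0 : 0 <= T.
Hypothesis FS : forall t, sigma_algebra [set: Om] (F t).
Hypothesis FM : forall t, F t `<=` measurable.
Hypothesis Fle : forall s t, s <= t -> F s `<=` F t.
Hypothesis M0 : forall w, M 0 w = 0.
Hypothesis MM : martingale P T F M.
Hypothesis MQ : martingale P T F (fun t w => (M t w) ^+ 2 - t * q).

Lemma martingale_L2 t : 0 <= t -> t <= T ->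
  L2 P (M t) /\ \int[P]_w (M t w ^+ 2) = q * t.
Proof.
move=> t0 tT; have iM2 := intg_martingale2 MQ t0 tT.
split.
  split=> //; exact: (mF_mfun FM (mF_martingale Fle MM t0 (lexx _) tT)).
have := @EX_weight_increment2 _ _ _ P T F M q FS FM MQ 0 t (fun=> 1) 1 (lexx _) t0 tT
  (measurable_cst _) (fun w => _).
move=> /(_ ltac:(by rewrite normr1)).
under eq_Rintegral do rewrite mul1r M0 expr0n/= !subr0.
rewrite EXB ?EX_cst//; last exact: intg_cst.
by move/eqP; rewrite subr_eq0 => /eqP.
Qed.

(** Truncate [Y] at level [n] and let [n] tend to infinity. *)
Lemma EX_L2_weight Y : measurable_fun [set: g_sigma_algebraType (F 0)]
    (Y : g_sigma_algebraType (F 0) -> R) -> L2 P Y ->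
  \int[P]_w (Y w * M T w) = 0.
Proof.
move=> mY LY; have [LM _] := martingale_L2 T0 (lexx T).
have iYM := L2_intgM LY LM.
pose A n : set Om := [set w | `|Y w| <= n%:R].
have mA n : <<s F 0 >> (A n).
  have -> : A n = Y @^-1` `[- n%:R, n%:R].
    by apply/seteqP; split => w; rewrite /A /= in_itv/= ler_norml.
  by rewrite -[X in <<s _ >> X]setTI; exact: mY.
have mA' n : measurable (A n) by exact: (sub_measurable (@FM 0)).
have c : \int[P]_w (\1_(A n) w * (Y w * M T w)) @[n --> \oo] --> \int[P]_w (Y w * M T w).
  apply: (@dct_cvg _ _ _ P _ _ (fun w => `|Y w * M T w|)).
  - by move=> n; exact: (intg_mfun (intg_indicM (mA' n) iYM)).
  - exact: intg_mfun iYM.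
  - exact: intg_norm.
  - apply: aeW => w; apply: cvg_near_cst.
    have [n0 _ Hn] := @nbhs_infty_ger R `|Y w|.
    by exists n0 => // n /Hn h; rewrite indicE mem_set// mul1r.
  - move=> n w; rewrite normrM ler_piMl// indicE.
    by case: (w \in A n); rewrite ?normr1 ?normr0.
have z n : \int[P]_w (\1_(A n) w * (Y w * M T w)) = 0.
  under eq_Rintegral => w _ do rewrite mulrA -[M T w]subr0 -(M0 w).
  apply: (EX_weight_increment FS FM MM (lexx 0) T0 (lexx T) (B := n%:R)).
    by apply: measurable_funM => //; apply: measurable_indic; exact: mA.
  move=> w; rewrite indicE; have [/set_mem h|_] := boolP (w \in A n).
    by rewrite mul1r.
  by rewrite mul0r normr0.
apply/esym/(cvg_unique (@Rhausdorff R) _ c).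
by rewrite (_ : (fun n => _) = (fun=> 0)); [exact: cvg_cst|apply/funext].
Qed.

End L2_weight.

(** * The linear drift of a stationary solution *)

Section drift_functionals.
Context (R : realType) (I : choiceType) (c : I -> {posnum R}) (nbr : rel I).
Variables (kappa deg : R).
Local Notation E := (ell2 c).

Definition nbs x : seq I := finmap.enum_fset (fset_set [set y | nbr x y]).

Hypothesis nbr_finite : forall x, finite_set [set y | nbr x y].
Hypothesis nbr_deg : forall x, (size (nbs x))%:R <= deg.
Hypothesis kappa0 : 0 <= kappa.
Hypothesis kappa_deg : kappa * deg <= 1 / 16.

Variable mu : probability (borel E) R.
Hypothesis mu1 : in_P1 mu.

Definition corr x y : R := \int[mu]_u ((u : E) x * (u : E) y).
Definition self_rate x : R := \sum_(y <- nbs x) corr x y.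

(** When all marginals are the same law [mu], the moments in the drift are constants,
    and the drift at [x] becomes a fixed functional of the configuration. *)
Definition drift_list x : seq (R * I) :=
  (- (2 * kappa * self_rate x + 2^-1), x) :: [seq (2 * kappa, y) | y <- nbs x].

Definition gen s := flatten [seq scale p.1 (drift_list p.2) | p <- s].

(** One Euler step of the linear flow dual to the drift. The damping is merged into
    the entry that it damps, rather than appended as in [s ++ scale t (gen s)]:
    the cancellation between the two is what makes [nrm] contract. *)
Definition euler (t : R) (s : seq (R * I)) : seq (R * I) :=
  flatten [seq (p.1 * (1 - t * (2 * kappa * self_rate p.2 + 2^-1)), p.2) ::
               [seq (p.1 * (t * (2 * kappa)), y) | y <- nbs p.2] | p <- s].

Lemma L2_coord x : L2le mu (fun v : borel E => (v : E) x) 1.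
Proof. by apply: L2le_ereal; [exact: measurable_coord|exact: mu1]. Qed.

Lemma L2_lin s : L2le mu (fun v : borel E => lin s (v : E)) (nrm s ^+ 2).
Proof.
rewrite -[nrm s ^+ 2]mulr1.
exact: (@L2le_weighted_sum _ _ _ mu _ s (fun x (v : borel E) => (v : E) x) 1 L2_coord).
Qed.

Lemma corr_le1 x y : `|corr x y| <= 1.
Proof.
have [Lx x1] := L2_coord x; have [Ly y1] := L2_coord y.
have ix := intgZ 2^-1 Lx.2; have iy := intgZ 2^-1 Ly.2.
apply: (le_trans (le_norm_EX (L2_intgM Lx Ly) (intgD ix iy) _)).
  move=> v; have := sqr_ge0 ((v : E) x - (v : E) y); have := sqr_ge0 ((v : E) x + (v : E) y).
  by rewrite ler_norml => h1 h2; apply/andP; split; nra.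
rewrite EXD// !EXZ; [lra|exact: Ly.2|exact: Lx.2].
Qed.

Lemma self_rate_le x : `|self_rate x| <= deg.
Proof.
rewrite (le_trans (ler_norm_sum _ _ _))// (le_trans _ (nbr_deg x))//.
rewrite -[leRHS]mul1r -sumr_seq_cst; apply: ler_sum => y _; exact: corr_le1.
Qed.

Lemma driftE (nu : probability (borel E) R) v x : same_law nu mu ->
  drift nbr kappa v nu x = lin (drift_list x) v.
Proof.
move=> numu; rewrite /drift lin_cons /= /lin big_map/= -mulr_sumr.
rewrite !fsbig_finite//.
have E : \sum_(y <- nbs x) \int[nu]_u ((u : E) x * (u : E) y) = self_rate x.
  apply: eq_bigr => y _; rewrite /corr /Rintegral.
  by rewrite (@eq_measure_integral _ _ _ _ mu)// => A mA _; exact: numu.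
by rewrite E /nbs; ring.
Qed.

(** The nonlinear part of the damping is at most a quarter of the linear part, as
    correlations are bounded by [1]. *)
Let damping x : 3 / 8 <= 2 * kappa * self_rate x + 2^-1 <= 5 / 8.
Proof.
have := self_rate_le x; rewrite ler_norml => /andP[h1 h2].
have := ler_wpM2l kappa0 h1; have := ler_wpM2l kappa0 h2; rewrite mulrN -mulrA.
have kd := kappa_deg.
by set a := kappa * self_rate x; set b := kappa * deg in kd *; lra.
Qed.

Let coupling x : kappa * (size (nbs x))%:R <= 1 / 16.
Proof. by apply: le_trans kappa_deg; rewrite ler_wpM2l. Qed.

Lemma nrm_drift_list x : nrm (drift_list x) <= 1.
Proof.
rewrite nrm_cons /nrm big_map/= sumr_seq_cst normrN.
have /andP[h1 h2] := damping x; rewrite ger0_norm; last by lra.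
rewrite ger0_norm; last by rewrite mulr_ge0.
by have := coupling x; lra.
Qed.

Lemma gen_cons p s : gen (p :: s) = scale p.1 (drift_list p.2) ++ gen s.
Proof. by []. Qed.

Lemma euler_cons t p s : euler t (p :: s) =
  (p.1 * (1 - t * (2 * kappa * self_rate p.2 + 2^-1)), p.2) ::
    ([seq (p.1 * (t * (2 * kappa)), y) | y <- nbs p.2] ++ euler t s).
Proof. by []. Qed.

Lemma lin_gen s v : lin (gen s) v = \sum_(p <- s) p.1 * lin (drift_list p.2) v.
Proof.
elim: s => [|p s ih]; first by rewrite big_nil /gen /= /lin big_nil.
by rewrite big_cons -ih gen_cons lin_cat lin_scale.
Qed.

Lemma nrm_gen s : nrm (gen s) <= nrm s.
Proof.
elim: s => [//|p s ih]; rewrite gen_cons nrm_cat nrm_cons lerD// nrm_scale.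
by rewrite ler_piMr// nrm_drift_list.
Qed.

Lemma lin_euler t s v : lin (euler t s) v = lin s v + t * lin (gen s) v.
Proof.
elim: s => [|p s ih]; first by rewrite /gen /= /lin !big_nil mulr0 addr0.
rewrite gen_cons (lin_cat (scale _ _)) lin_scale euler_cons !lin_cons lin_cat ih /=.
by rewrite /lin !big_map/= -!mulr_sumr; ring.
Qed.

(** The damping rate is at least [3/8] and the coupling to the neighbors costs at
    most [1/8]. *)
Lemma nrm_euler t s : 0 <= t -> t <= 1 -> nrm (euler t s) <= (1 - t / 4) * nrm s.
Proof.
move=> t0 t1; elim: s => [|p s ih]; first by rewrite /nrm !big_nil mulr0.
rewrite euler_cons !nrm_cons nrm_cat (mulrDr (1 - t / 4)) addrA lerD//.
rewrite /nrm big_map/= sumr_seq_cst !normrM [leRHS]mulrC -(mulrA `|p.1|) -[leLHS]mulrDr ler_wpM2l//.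
have /andP[h1 h2] := damping p.2; have h3 := coupling p.2.
set b := 2 * kappa * self_rate p.2 + 2^-1 in h1 h2 *.
rewrite (ger0_norm t0) (ger0_norm kappa0) (ger0_norm (ler0n _ 2)).
rewrite ger0_norm; last by nra.
by set k := _%:R in h3 *; nra.
Qed.

Lemma coeff1 (x y : I) : coeff [:: (1 : R, x)] y = (x == y)%:R.
Proof. by rewrite /coeff big_cons big_nil /=; case: (x == y); rewrite ?addr0. Qed.

Lemma rate1 (x : I) : rate [:: (1 : R, x)] = 1.
Proof.
have -> : rate [:: (1 : R, x)] = pairing (coeff [:: (1 : R, x)]) (coeff [:: (1, x)]).
  by apply: eq_fsbigr => y _; rewrite expr2.
by rewrite pairing_coeff /lin big_cons big_nil /= coeff1 eqxx mulr1 addr0.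
Qed.

(** * One step of a stationary solution *)

Section solution.
Variable T : R.
Hypotheses (T0 : 0 < T) (T1 : T <= 1).
Local Notation Omega := (borel (path_space E T)).
Variable P : probability Omega R.
Hypothesis solP : martingale_solution nbr kappa P mu.
Hypothesis statP : forall t, 0 <= t <= T -> same_law (marginal P t) mu.

Let F := @path_filtration R I c T.

Let FS t : sigma_algebra [set: Omega] (F t).
Proof. exact: smallest_sigma_algebra. Qed.

Let FM t : F t `<=` measurable.
Proof.
apply: smallest_sub; first exact: sigma_algebra_measurable.
move=> _ [s _ [B mB ->]]; rewrite -[X in measurable X]setTI.
exact: (@measurable_eval_path _ E T s).
Qed.

Let Fle s t : s <= t -> F s `<=` F t.
Proof.
move=> st; apply: sub_sigma_algebra2 => _ [r /andP[r0 rs] [B mB ->]].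
by exists r; [rewrite r0 (le_trans rs)|exists B].
Qed.

Let pos t (w : Omega) : E := eval_path t w.
Let X s t (w : Omega) : R := lin s (pos t w).
Let M s := mf_process nbr kappa P (coeff s).

Let mX s t : measurable_fun [set: Omega] (X s t).
Proof.
apply: (@measurableT_comp _ _ _ _ _ _ (fun v : borel E => lin s (v : E)) _ (@eval_path _ E T t)).
  exact: measurable_lin.
exact: measurable_eval_path.
Qed.

Let path_continuous s w : {within `[0, T], continuous (fun t => X s t w)}.
Proof.
apply/subspace_sigL_continuousP.
rewrite (_ : sigL _ _ = (fun v : E => lin s v) \o path_fun w); last first.
  by apply/funext => t; rewrite /sigL /X /pos /= -eval_pathE.
move=> t; apply: continuous_comp; first exact: cts_fun.
exact: lin_continuous.
Qed.

Let intC f : {within `[0, T], continuous f} ->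
  lebesgue_measure.-integrable `[0, T] (EFin \o f).
Proof. by move=> cf; apply: continuous_compact_integrable => //; exact: segment_compact. Qed.

(** Only the marginals of [P] are known, so stationarity is used for functions of the
    configuration at a single time. *)
Lemma EX_stationary_bounded (f : E -> R) B t : 0 <= t <= T ->
  measurable_fun [set: borel E] (f : borel E -> R) -> (forall v, `|f v| <= B) ->
  \int[P]_w f (pos t w) = \int[mu]_v f v.
Proof.
move=> tT mf fB; rewrite /Rintegral.
rewrite -(@eq_measure_integral _ _ _ _ _ (marginal P t)); last first.
  by move=> A mA _; exact: statP.
rewrite integral_distribution//; first exact/measurable_EFinP.
apply: (@intg_bounded _ _ _ P (fun w => f (pos t w)) B) => //.
exact: (@measurableT_comp _ _ _ _ _ _ _ _ (@eval_path _ E T t)).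
Qed.

Lemma EX_stationary_ge0 (f : E -> R) t : 0 <= t <= T ->
  measurable_fun [set: borel E] (f : borel E -> R) -> (forall v, 0 <= f v) ->
  (\int[P]_w (f (pos t w))%:E = \int[mu]_v (f v)%:E)%E.
Proof.
move=> tT mf f0.
rewrite -(@eq_measure_integral _ _ _ _ _ (marginal P t)); last first.
  by move=> A mA _; exact: statP.
by rewrite ge0_integral_distribution//; exact/measurable_EFinP.
Qed.

Let msqr s : measurable_fun [set: borel E] (fun v : borel E => lin s (v : E) ^+ 2).
Proof. by apply: measurable_funX; exact: measurable_lin. Qed.

Lemma EX_sqr_stationary s t : 0 <= t <= T ->
  \int[P]_w (X s t w ^+ 2) = \int[mu]_v (lin s (v : E) ^+ 2).
Proof.
by move=> tT; rewrite /Rintegral (EX_stationary_ge0 tT (msqr s))// => v; exact: sqr_ge0.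
Qed.

Let L2_X s t : 0 <= t <= T -> L2le P (X s t) (nrm s ^+ 2).
Proof.
move=> tT; apply: L2le_ereal; first exact: mX.
rewrite (EX_stationary_ge0 tT (msqr s)); last by move=> v; exact: sqr_ge0.
exact: L2leP (L2_lin s).
Qed.

Let ME s t w : 0 <= t -> t <= T ->
  M s t w = X s t w - X s 0 w - \int[lebesgue_measure]_(r in `[0, t]) X (gen s) r w.
Proof.
move=> t0 tT; rewrite /M /mf_process !pairing_coeff; congr (_ - _).
apply: eq_Rintegral => r; rewrite inE/= in_itv/= => /andP[r0 rt].
rewrite pairing_coeff /X lin_gen /lin; apply: eq_bigr => p _.
congr (_ * _); apply: driftE; apply: statP.
by rewrite r0 (le_trans rt).
Qed.

Let M0 s w : M s 0 w = 0.
Proof.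
by rewrite ME ?(ltW T0)// set_itv1 Rintegral_set1 subrr subr0.
Qed.

Let MM s : martingale P T F (M s).
Proof. by case: solP => _ _ /(_ _ (coeff_finite s))[]. Qed.

Let cM s : as_continuous P T (M s).
Proof. by case: solP => _ _ /(_ _ (coeff_finite s))[]. Qed.

Let MQ s : martingale P T F (fun t w => M s t w ^+ 2 - t * rate s).
Proof. by case: solP => _ _ /(_ _ (coeff_finite s))[_ _ _ []]. Qed.

Let L2_M s t : 0 <= t -> t <= T -> L2 P (M s t) /\ \int[P]_w (M s t w ^+ 2) = rate s * t.
Proof. exact: (martingale_L2 FS FM Fle (M0 s) (MM s) (MQ s)). Qed.

(** The increment is the time integral of the drift, of second moment at most [t^2],
    plus a martingale of variance [t]. *)
Let L2_increment x t : 0 <= t -> t <= T ->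
  L2le P (fun w => pos t w x - pos 0 w x) (4 * t).
Proof.
move=> t0 tT; set s := [:: (1 : R, x)].
have XE r w : X s r w = pos r w x by rewrite /X /lin big_cons big_nil /= mul1r addr0.
move: t0; rewrite le_eqVlt => /predU1P[<-|t0].
  rewrite mulr0 (_ : (fun w => _) = fun=> 0); last by apply/funext => w; rewrite subrr.
  split; first exact: L2_cst.
  by under eq_Rintegral do rewrite expr0n; rewrite EX_cst.
have -> : (fun w => pos t w x - pos 0 w x) =
    (fun w => \int[lebesgue_measure]_(r in `[0, t]) X (gen s) r w + M s t w).
  by apply/funext => w; rewrite ME ?(ltW t0)// !XE; ring.
have LI : L2le P (fun w => \int[lebesgue_measure]_(r in `[0, t]) X (gen s) r w) (t ^+ 2 * 1).
  apply: L2le_time_integral => //.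
    move=> w; have := @path_continuous (gen s) w; apply: continuous_subspaceW.
    by apply: subset_itvl; rewrite bnd_simp.
  move=> r /andP[r0 rt]; apply: L2le_weak (L2_X _ _) _.
    by rewrite r0 (le_trans rt).
  rewrite expr_le1// ?nrm_ge0// (le_trans (nrm_gen s))//.
  by rewrite nrm_cons /nrm big_nil normr1 addr0.
have [LM EM] := L2_M s (ltW t0) tT; rewrite rate1 mul1r in EM.
have EM' : \int[P]_w (M s t w ^+ 2) <= t by rewrite EM.
have := L2leD LI (conj LM EM') => /L2le_weak; apply.
by have t1 := le_trans tT T1; rewrite expr2; nra.
Qed.

(** The error made by freezing the drift at time [0]; [euler T s] collects the initial
    value and the frozen drift. *)
Definition remainder s w := X s T w - X (euler T s) 0 w - M s T w.

(** It is the time integral of the increments of the drift, each of second moment of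
    order [T], whence the order [T^3]. *)
Lemma L2_remainder s : L2le P (remainder s) (4 * nrm s ^+ 2 * T ^+ 3).
Proof.
have cY w : {within `[0, T], continuous (fun r => X (gen s) r w - X (gen s) 0 w)}.
  move=> r; apply: (@cvgB _ _ _ _ _ (fun r : subspace `[0, T] => X (gen s) r w)
    (fun _ : subspace `[0, T] => X (gen s) 0 w)).
    exact: path_continuous.
  exact: cvg_cst.
have -> : remainder s = fun w => \int[lebesgue_measure]_(r in `[0, T])
    (X (gen s) r w - X (gen s) 0 w).
  apply/funext => w; rewrite RintegralB//; last 2 first.
  - exact/intC/path_continuous.
  - by apply: intC => r; exact: cvg_cst.
  have lenT : lebesgue_measure (`[0, T]%classic : set R) = T%:E.
    by rewrite lebesgue_measure_itv/= lte_fin T0 oppr0 adde0.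
  rewrite Rintegral_cst// [X in _ * X](_ : _ = T); last exact: (congr1 fine lenT).
  by rewrite /remainder ME ?(ltW T0)// /X lin_euler /=; ring.
have -> : 4 * nrm s ^+ 2 * T ^+ 3 = T ^+ 2 * (nrm s ^+ 2 * (4 * T)) by ring.
apply: L2le_time_integral => // r /andP[r0 rT].
have -> : (fun w => X (gen s) r w - X (gen s) 0 w) =
    (fun w => \sum_(p <- gen s) p.1 * (pos r w p.2 - pos 0 w p.2)).
  apply/funext => w; rewrite /X /lin -sumrB; apply: eq_bigr => p _; ring.
apply: L2le_weak (@L2le_weighted_sum _ _ _ P _ (gen s)
  (fun x w => pos r w x - pos 0 w x) (4 * T) _) _.
  move=> x; apply: L2le_weak (L2_increment x r0 rT) _.
  by rewrite ler_pM2l.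
rewrite -/(nrm (gen s)) ler_wpM2r ?mulr_ge0 ?(ltW T0)//.
by rewrite lerXn2r ?nnegrE ?nrm_ge0// nrm_gen.
Qed.

Let mX0 s : measurable_fun [set: g_sigma_algebraType (F 0)]
  (X s 0 : g_sigma_algebraType (F 0) -> R).
Proof.
move=> _ B mB; rewrite setTI; apply: sub_sigma_algebra; apply: sub_sigma_algebra.
exists 0; first by rewrite lexx.
exists ((fun v : E => lin s v) @^-1` B) => //.
by rewrite -[X in measurable X]setTI; exact: (@measurable_lin _ _ c s).
Qed.

Let T00 : 0 <= (0 : R) <= T. Proof. by rewrite lexx ltW. Qed.
Let T0T : 0 <= T <= T. Proof. by rewrite lexx ltW. Qed.

Let L2_Y s : L2 P (X (euler T s) 0) /\ \int[P]_w (X (euler T s) 0 w ^+ 2) <= nrm s ^+ 2.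
Proof.
have [LY EY] := L2_X (euler T s) T00; split => //; apply: (le_trans EY).
rewrite lerXn2r ?nnegrE ?nrm_ge0// (le_trans (nrm_euler s (ltW T0) T1))//.
by rewrite ler_piMl ?nrm_ge0// lerBlDr lerDl divr_ge0// ltW.
Qed.

(** At time [T] the value of [lin s] is that of [lin (euler T s)] at time [0], which
    belongs to the past, plus the martingale, plus the remainder. The martingale
    contributes its Gaussian factor and the remainder its first moment. As both laws
    are [mu], this is an almost invariance of the characteristic function of [mu]
    under [euler T]. The phase [al] covers sines and cosines at once. *)
Lemma char_step s (al tau : R) : 0 <= tau -> T = tau ^+ 2 ->
  `|\int[mu]_v cos (al + lin s (v : E)) -
    expR (- (rate s * T / 2)) * \int[mu]_v cos (al + lin (euler T s) (v : E))|
  <= 2 * nrm s * tau ^+ 3.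
Proof.
move=> tau0 TE.
have mcos s' : measurable_fun [set: borel E] (fun v : borel E => cos (al + lin s' (v : E))).
  apply: (@measurableT_comp _ _ _ _ _ _ (@cos R)).
    by apply: continuous_measurable_fun; exact: continuous_cos.
  by apply: measurable_funD => //; exact: measurable_lin.
have cos1 (x : R) : `|cos x| <= 1 by rewrite ler_norml cos_le1 cos_geN1.
rewrite -(EX_stationary_bounded T0T (mcos s) (B := 1))//.
rewrite -(EX_stationary_bounded T00 (mcos (euler T s)) (B := 1))//.
rewrite -/(X _ _ _).
pose H w := al + X (euler T s) 0 w.
have mH : measurable_fun [set: g_sigma_algebraType (F 0)]
    (H : g_sigma_algebraType (F 0) -> R).
  by apply: measurable_funD => //; exact: mX0.
have <- := levy T0 (rate_ge0 s) FS FM Fle (M0 s) (@cM s) (MM s) (MQ s) mH.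
have [LM _] := L2_M s (ltW T0) (lexx T).
have mH' := mF_mfun FM mH.
have ib f : measurable_fun [set: Omega] f -> P.-integrable [set: Omega] (EFin \o (fun w => cos (f w))).
  move=> mf; apply: (@intg_bounded _ _ _ P _ 1) => //.
  apply: measurableT_comp => //.
  by apply: continuous_measurable_fun; exact: continuous_cos.
have i1 : P.-integrable [set: Omega] (EFin \o (fun w => cos (al + X s T w))).
  by apply: ib; apply: measurable_funD => //; exact: mX.
have i2 : P.-integrable [set: Omega] (EFin \o (fun w => cos (H w + M s T w))).
  by apply: ib; apply: measurable_funD => //; exact: LM.1.
have Lr := L2_remainder s.
rewrite -EXB//; apply: (@le_trans _ _ (\int[P]_w `|remainder s w|)).
  apply: le_norm_EX; [exact: intgB|exact/intg_norm/L2_intg/Lr.1|].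
  move=> w; apply: (le_trans (cos_lip _ _)); rewrite le_eqVlt; apply/orP; left.
  by apply/eqP; congr (`|_|); rewrite /H /remainder /X; ring.
apply: L2le_norm1; first by rewrite mulr_ge0 ?exprn_ge0// mulr_ge0// nrm_ge0.
by apply: (L2le_weak Lr); rewrite TE le_eqVlt; apply/orP; left; apply/eqP; ring.
Qed.

(** The same decomposition for second moments: the initial value is orthogonal to the
    martingale, of variance [rate s * T]. The remainder is of size [tau ^ 3] in L^2,
    so its products with the other terms are balanced by the weight [tau ^ 3] in
    [2 z r <= tau^3 z^2 + tau^-3 r^2]. What is left is of first order in
    [T = tau ^ 2], up to an error of order [tau ^ 3]. *)
Lemma variance_step s (tau : R) : 0 < tau -> T = tau ^+ 2 ->
  `|2 * \int[mu]_v (lin s (v : E) * lin (gen s) (v : E)) + rate s| <=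
  (11 * nrm s ^+ 2 + 2 * rate s) * tau.
Proof.
move=> tau0 TE.
have tau1 : tau <= 1 by rewrite -(@expr_le1 _ 2%N) ?(ltW tau0)// -TE.
have [LY EY] := L2_Y s.
have [LM EM] := L2_M s (ltW T0) (lexx T).
have [Lr Er] := L2_remainder s.
have [LX _] := L2_X s T0T.
have iYM := L2_intgM LY LM.
have YM0 : \int[P]_w (X (euler T s) 0 w * M s T w) = 0.
  exact: (EX_L2_weight (ltW T0) FS FM Fle (M0 s) (MM s) (MQ s) (@mX0 _) LY).
have LZ := L2D LY LM; have iZr := L2_intgM LZ Lr.
have EZ : \int[P]_w ((X (euler T s) 0 w + M s T w) ^+ 2) =
    \int[P]_w (X (euler T s) 0 w ^+ 2) + rate s * T.
  have i0 := intgD LY.2 LM.2; have i1 := intgZ 2 iYM.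
  rewrite -EM -(EXD LY.2 LM.2).
  transitivity (\int[P]_w ((X (euler T s) 0 w ^+ 2 + M s T w ^+ 2) +
      2 * (X (euler T s) 0 w * M s T w))).
    by apply: eq_Rintegral => w _; ring.
  by rewrite (EXD i0 i1) (EXZ 2 iYM) YM0 mulr0 addr0.
have EX2 : \int[P]_w (X s T w ^+ 2) = \int[P]_w (X (euler T s) 0 w ^+ 2) + rate s * T +
    (2 * \int[P]_w ((X (euler T s) 0 w + M s T w) * remainder s w) +
     \int[P]_w (remainder s w ^+ 2)).
  rewrite -EZ -EXZ// -EXD; [|exact: intgZ|exact: Lr.2].
  rewrite -EXD; [|exact: LZ.2|by apply: intgD; [exact: intgZ|exact: Lr.2]].
  by apply: eq_Rintegral => w _; rewrite /remainder; ring.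
have cross : `|2 * \int[P]_w ((X (euler T s) 0 w + M s T w) * remainder s w)| <=
    tau ^+ 3 * (nrm s ^+ 2 + rate s * T) + 4 * nrm s ^+ 2 * tau ^+ 3.
  have t3 : 0 < tau ^+ 3 by rewrite exprn_gt0.
  rewrite -EXZ//.
  have iZ2 := intgZ (tau ^+ 3) LZ.2; have ir2 := intgZ (tau ^+ 3)^-1 Lr.2.
  apply: (le_trans (le_norm_EX (intgZ 2 iZr) (intgD iZ2 ir2) _)).
    move=> w; set z := _ + _; set r := remainder s w.
    have t3i : 0 < (tau ^+ 3)^-1 by rewrite invr_gt0.
    have h1 := mulr_ge0 (ltW t3i) (sqr_ge0 (tau ^+ 3 * z - r)).
    have h2 := mulr_ge0 (ltW t3i) (sqr_ge0 (tau ^+ 3 * z + r)).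
    have e1 : (tau ^+ 3)^-1 * (tau ^+ 3 * z - r) ^+ 2 =
       tau ^+ 3 * z ^+ 2 + (tau ^+ 3)^-1 * r ^+ 2 - 2 * (z * r).
      by field; rewrite gt_eqF.
    have e2 : (tau ^+ 3)^-1 * (tau ^+ 3 * z + r) ^+ 2 =
       tau ^+ 3 * z ^+ 2 + (tau ^+ 3)^-1 * r ^+ 2 + 2 * (z * r).
      by field; rewrite gt_eqF.
    by rewrite ler_norml; apply/andP; split; lra.
  rewrite EXD// EXZ; last exact: LZ.2.
  rewrite EXZ; last exact: Lr.2.
  apply: lerD; first by rewrite ler_pM2l// EZ lerD2r.
  rewrite ler_pdivrMl// (le_trans Er)// TE le_eqVlt; apply/orP; left; apply/eqP; ring.
have E2 : \int[P]_w (X (euler T s) 0 w ^+ 2) = \int[mu]_v (lin s (v : E) ^+ 2) +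
   (2 * T * \int[mu]_v (lin s (v : E) * lin (gen s) (v : E)) +
    T ^+ 2 * \int[mu]_v (lin (gen s) (v : E) ^+ 2)).
  rewrite (EX_sqr_stationary _ T00).
  have [Ls _] := L2_lin s; have [Lg _] := L2_lin (gen s).
  have ig := L2_intgM Ls Lg.
  rewrite -EXZ// -EXZ; last exact: Lg.2.
  have j1 := intgZ (2 * T) ig; have j2 := intgZ (T ^+ 2) Lg.2.
  rewrite -EXD// -EXD; [|exact: Ls.2|exact: intgD].
  by apply: eq_Rintegral => v _; rewrite lin_euler; ring.
have Eg : 0 <= \int[mu]_v (lin (gen s) (v : E) ^+ 2) <= nrm s ^+ 2.
  apply/andP; split; first by apply: Rintegral_ge0 => v _; exact: sqr_ge0.
  have [_ h] := L2_lin (gen s); apply: (le_trans h).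
  by rewrite lerXn2r ?nnegrE ?nrm_ge0// nrm_gen.
have Er0 : 0 <= \int[P]_w (remainder s w ^+ 2).
  by apply: Rintegral_ge0 => w _; exact: sqr_ge0.
move: EX2; rewrite E2 (EX_sqr_stationary _ T0T).
move: cross Er Er0 Eg.
set a := \int[mu]_v (lin s _ * _); set g := \int[mu]_v (lin (gen s) _ ^+ 2).
set r := \int[P]_w (remainder s w ^+ 2); set z := 2 * \int[P]_w _.
set b := \int[mu]_v _; set N := nrm s ^+ 2; set q := rate s; rewrite TE.
have q0 : 0 <= q := rate_ge0 s.
have N0 : 0 <= N by exact: sqr_ge0.
move=> cross Er Er0 /andP[g0 gN] EE.
have {}EE : tau ^+ 2 * (2 * a + q) = - (tau ^+ 2) ^+ 2 * g - z - r by lra.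
rewrite -(@ler_pM2l _ (tau ^+ 2)) ?exprn_gt0// -[X in X * `|_|]ger0_norm ?sqr_ge0//.
rewrite -normrM EE; move: cross; rewrite ler_norml => /andP[c1 c2].
have t3 : 0 < tau ^+ 3 by rewrite exprn_gt0.
have -> : tau ^+ 2 * ((11 * N + 2 * q) * tau) = tau ^+ 3 * (11 * N + 2 * q) by ring.
have f1 : (tau ^+ 2) ^+ 2 * g <= tau ^+ 3 * N.
  apply: ler_pM => //; first by rewrite exprn_ge0// sqr_ge0.
  by rewrite -exprM (_ : (2 * 2 = 3.+1)%N)// exprS ler_piMl// ltW.
have f10 : 0 <= (tau ^+ 2) ^+ 2 * g by rewrite mulr_ge0// sqr_ge0.
have f2 : 4 * N * (tau ^+ 2) ^+ 3 <= tau ^+ 3 * (4 * N).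
  have h : (tau ^+ 2) ^+ 3 <= tau ^+ 3.
    rewrite -exprM (_ : (2 * 3 = 3 + 3)%N)// exprD.
    by rewrite ler_piMl ?(ltW t3)// exprn_ile1// ltW.
  by rewrite [leRHS]mulrC ler_wpM2l// mulr_ge0.
have f3 : tau ^+ 3 * (N + q * tau ^+ 2) <= tau ^+ 3 * (N + q).
  by rewrite ler_pM2l// lerD2l ler_piMr// -TE.
by rewrite ler_norml; apply/andP; split; nra.
Qed.

End solution.

End drift_functionals.

(** * Uniqueness of the covariances and of the characteristic function *)

Section small_parameter.
Context (R : realType).

Lemma norm_le_small (a C : R) : (forall tau, 0 < tau -> tau <= 1 -> `|a| <= C * tau) -> a = 0.
Proof.
move=> h; apply/eqP; rewrite -normr_le0; apply/ler_addgt0Pr => e e0; rewrite add0r.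
have K0 : 0 < `|C| + 1 by rewrite ltr_wpDl.
pose tau := Num.min 1 (e / (`|C| + 1)).
have tau0 : 0 < tau by rewrite lt_min ltr01 divr_gt0.
have tau1 : tau <= 1 by rewrite ge_min lexx.
have taue : tau <= e / (`|C| + 1) by rewrite ge_min lexx orbT.
apply: (le_trans (h _ tau0 tau1)); rewrite ler_pdivlMr// in taue.
apply: le_trans taue; rewrite mulrC ler_wpM2l ?(ltW tau0)//.
by have := ler_norm C; lra.
Qed.

Lemma geometric_zero (a b : R) (r : R) : 0 <= r -> r < 1 -> 
  (forall n, `|a| <= b * r ^+ n) -> a = 0.
Proof.
move=> r0 r1 h; apply/eqP; rewrite -normr_le0.
have c : b * r ^+ n @[n --> \oo] --> b * 0.
  by apply: cvgMr; apply: cvg_expr; rewrite ger0_norm.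
rewrite mulr0 in c.
by apply: (cvgr_to_ge c); exact: nearW.
Qed.

End small_parameter.

Section uniqueness.
Context (R : realType) (I : choiceType) (c : I -> {posnum R}) (nbr : rel I).
Variables (kappa deg : R).
Local Notation E := (ell2 c).
Hypothesis nbr_finite : forall x, finite_set [set y | nbr x y].
Hypothesis nbr_deg : forall x, (size (nbs nbr x))%:R <= deg.
Hypothesis kappa0 : 0 <= kappa.
Hypothesis kappa_deg : kappa * deg <= 1 / 16.

Let coupling x : kappa * (size (nbs nbr x))%:R <= 1 / 16.
Proof. by apply: le_trans kappa_deg; rewrite ler_wpM2l. Qed.

Section one_measure.
Variable mu : probability (borel E) R.
Hypothesis mu1 : in_P1 mu.
Hypothesis mu_stat : stationary nbr kappa mu.

Lemma corrC x y : corr mu x y = corr mu y x.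
Proof. by apply: eq_Rintegral => v _; rewrite mulrC. Qed.

(** [variance_step] as the time step tends to zero; the solution depends on the time
    horizon, but its second moments do not. *)
Lemma lyapunov s : 2 * \int[mu]_v (lin s (v : E) * lin (gen nbr kappa mu s) (v : E)) +
  rate s = 0.
Proof.
apply: (@norm_le_small _ _ (11 * nrm s ^+ 2 + 2 * rate s)) => tau tau0 tau1.
have T0 : 0 < tau ^+ 2 by rewrite exprn_gt0.
have T1 : tau ^+ 2 <= 1 by rewrite exprn_ile1// ltW.
have [P [solP statP]] := mu_stat T0.
exact: (variance_step nbr_finite nbr_deg kappa0 kappa_deg mu1 T0 T1 solP statP s tau0 erefl).
Qed.

Let Lx x : L2 mu (fun v : borel E => (v : E) x).
Proof. by have [] := L2_coord mu1 x. Qed.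

Let Ls s : L2 mu (fun v : borel E => lin s (v : E)).
Proof. by have [] := L2_lin mu1 s. Qed.

Lemma corr_lin x s : \int[mu]_v ((v : E) x * lin s (v : E)) = lin s (corr mu x).
Proof.
elim: s => [|p s ih].
  under eq_Rintegral do rewrite /lin big_nil mulr0.
  by rewrite EX_cst /lin big_nil.
rewrite lin_cons -ih /corr -EXZ; last exact: L2_intgM.
rewrite -EXD; [|apply: intgZ; exact: L2_intgM|exact: L2_intgM].
by apply: eq_Rintegral => v _; rewrite lin_cons; ring.
Qed.

(** The polar form of [lyapunov]. Its right hand side depends only on the sites, which
    is all that the comparison of two laws requires. *)
Lemma corr_equation x z :
  lin (drift_list nbr kappa mu z) (corr mu x) + lin (drift_list nbr kappa mu x) (corr mu z) =
  (rate [:: (1, x)] + rate [:: (1, z)] - rate [:: (1, x); (1, z)]) / 2.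
Proof.
have hx := lyapunov [:: (1, x)]; have hz := lyapunov [:: (1, z)].
have hxz := lyapunov [:: (1, x); (1, z)].
set g := gen nbr kappa mu in hx hz hxz.
have g1 y (v : E) : lin (g [:: (1, y)]) v = lin (drift_list nbr kappa mu y) v.
  by rewrite /g lin_gen big_cons big_nil /= mul1r addr0.
have l1 y (v : E) : lin [:: (1, y)] v = v y by rewrite /lin big_cons big_nil /= mul1r addr0.
have E1 y : \int[mu]_v (lin [:: (1, y)] (v : E) * lin (g [:: (1, y)]) (v : E)) =
    lin (drift_list nbr kappa mu y) (corr mu y).
  by rewrite -corr_lin; apply: eq_Rintegral => v _; rewrite g1 l1.
have ixz := L2_intgM (Lx x) (Ls (drift_list nbr kappa mu z)).
have izx := L2_intgM (Lx z) (Ls (drift_list nbr kappa mu x)).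
have ixx := L2_intgM (Lx x) (Ls (drift_list nbr kappa mu x)).
have izz := L2_intgM (Lx z) (Ls (drift_list nbr kappa mu z)).
have E2 : \int[mu]_v (lin [:: (1, x); (1, z)] (v : E) * lin (g [:: (1, x); (1, z)]) (v : E)) =
    lin (drift_list nbr kappa mu x) (corr mu x) + lin (drift_list nbr kappa mu z) (corr mu z) +
    (lin (drift_list nbr kappa mu z) (corr mu x) + lin (drift_list nbr kappa mu x) (corr mu z)).
  have i1 := intgD ixx izz; have i2 := intgD ixz izx.
  rewrite -!corr_lin -(EXD ixx izz) -(EXD ixz izx) -(EXD i1 i2).
  apply: eq_Rintegral => v _.
  rewrite /g lin_gen !big_cons big_nil /= /lin !big_cons big_nil /=; ring.
by rewrite !E1 in hx hz; rewrite E2 in hxz; lra.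
Qed.

(** The cosine is Lipschitz, and [lin s] has first absolute moment at most [nrm s]. *)
Lemma char_near_one s al :
  `|\int[mu]_v cos (al + lin s (v : E)) - cos al| <= nrm s.
Proof.
have cos1 (x : R) : `|cos x| <= 1 by rewrite ler_norml cos_le1 cos_geN1.
have i1 : mu.-integrable [set: borel E] (EFin \o (fun v : borel E => cos (al + lin s (v : E)))).
  apply: (@intg_bounded _ _ _ mu _ 1) => //.
  apply: (@measurableT_comp _ _ _ _ _ _ (@cos R)).
    by apply: continuous_measurable_fun; exact: continuous_cos.
  by apply: measurable_funD => //; exact: measurable_lin.
rewrite -(EX_cst mu (cos al)) -EXB//; last exact: intg_cst.
have [LS ES] := L2_lin mu1 s.
apply: (@le_trans _ _ (\int[mu]_v `|lin s (v : E)|)).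
  apply: le_norm_EX; [apply: intgB => //; exact: intg_cst|exact/intg_norm/L2_intg|].
  by move=> v; apply: (le_trans (cos_lip _ _)); rewrite addrC addKr.
by apply: L2le_norm1; [exact: nrm_ge0|split].
Qed.

End one_measure.

Variables mu nu : probability (borel E) R.
Hypotheses (mu1 : in_P1 mu) (nu1 : in_P1 nu).
Hypotheses (mu_stat : stationary nbr kappa mu) (nu_stat : stationary nbr kappa nu).

Let D x z := corr mu x z - corr nu x z.

(** Subtract the two covariance equations. The linear coupling contributes
    [4 kappa deg m <= m / 4], the difference of the dampings as much again since
    correlations are bounded by [1], and the coefficient of [D x z] is at least
    [3/4]. *)
Let D_contraction m : (forall x z, `|D x z| <= m) -> forall x z, `|D x z| <= m * (2 / 3).
Proof.
move=> Dm x z; have m0 : 0 <= m by apply: le_trans (Dm x z).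
have := corr_equation mu1 mu_stat x z; rewrite -(corr_equation nu1 nu_stat x z).
rewrite !lin_cons /= /lin !big_map/= -!mulr_sumr (corrC mu z x) (corrC nu z x).
set bx := self_rate nbr mu x; set bz := self_rate nbr mu z.
set bx' := self_rate nbr nu x; set bz' := self_rate nbr nu z.
have sumD y r (rE : r = nbs nbr y) w : `|\sum_(i <- r) corr mu w i - \sum_(i <- r) corr nu w i|
    <= m * (size r)%:R.
  rewrite -sumrB -sumr_seq_cst (le_trans (ler_norm_sum _ _ _))//.
  by apply: ler_sum => i _; exact: Dm.
have kb (y : I) w : `|kappa * (\sum_(i <- nbs nbr y) corr mu w i - \sum_(i <- nbs nbr y) corr nu w i)|
    <= m / 16.
  rewrite normrM (ger0_norm kappa0).
  apply: (le_trans (ler_wpM2l kappa0 (sumD y _ erefl w))).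
  by have := ler_wpM2l m0 (coupling y); rewrite mul1r mulrCA.
have bd y : `|kappa * self_rate nbr mu y| <= 1 / 16.
  rewrite normrM (ger0_norm kappa0) (le_trans _ kappa_deg)// ler_wpM2l//.
  exact: (self_rate_le nbr_deg mu1).
have h1 := kb z x; have h2 := kb x z.
have h3 := kb x x; have h4 := kb z z.
rewrite -/(self_rate nbr mu x) -/(self_rate nbr nu x) -/bx -/bx' in h3.
rewrite -/(self_rate nbr mu z) -/(self_rate nbr nu z) -/bz -/bz' in h4.
have h5 := bd x; have h6 := bd z; rewrite -/bx in h5; rewrite -/bz in h6.
set C := corr mu x z; set C' := corr nu x z.
have C1 : `|C'| <= 1 := corr_le1 nu1 x z.
set Sz := \sum_(i <- nbs nbr z) corr mu x i in h1 *.
set Sz' := \sum_(i <- nbs nbr z) corr nu x i in h1 *.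
set Sx := \sum_(i <- nbs nbr x) corr mu z i in h2 *.
set Sx' := \sum_(i <- nbs nbr x) corr nu z i in h2 *.
move=> eq; rewrite /D -/C -/C'.
set u := kappa * (Sz - Sz') in h1; set w := kappa * (Sx - Sx') in h2.
set p := kappa * (bx - bx') in h3; set r := kappa * (bz - bz') in h4.
set k1 := kappa * bx in h5; set k2 := kappa * bz in h6.
have {}eq : (2 * k1 + 2 * k2 + 1) * (C - C') = 2 * u + 2 * w - 2 * (p + r) * C'.
  by rewrite /u /w /p /r /k1 /k2; lra.
have : `|(2 * k1 + 2 * k2 + 1) * (C - C')| <= m / 2.
  rewrite eq; apply: (le_trans (ler_normB _ _)).
  have : `|2 * (p + r) * C'| <= m / 4.
    rewrite normrM -[leRHS]mulr1 ler_pM//.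
    move: h3 h4; rewrite !ler_norml => /andP[? ?] /andP[? ?]; apply/andP; split; lra.
  have : `|2 * u + 2 * w| <= m / 4.
    move: h1 h2; rewrite !ler_norml => /andP[? ?] /andP[? ?]; apply/andP; split; lra.
  lra.
rewrite normrM ger0_norm; last first.
  by move: h5 h6; rewrite !ler_norml => /andP[? ?] /andP[? ?]; lra.
have := normr_ge0 (C - C'); set n := `|C - C'| => n0.
have K34 : 3 / 4 <= 2 * k1 + 2 * k2 + 1.
  by move: h5 h6; rewrite !ler_norml => /andP[? ?] /andP[? ?]; lra.
by have := ler_wpM2r n0 K34; lra.
Qed.

(** Correlations differ by at most [2], and the difference contracts. *)
Lemma corr_unique x z : corr mu x z = corr nu x z.
Proof.
apply/eqP; rewrite -subr_eq0; apply/eqP.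
apply: (@geometric_zero _ _ 2 (2 / 3)); [lra|lra|].
move=> n; elim: n x z => [|n ih] x z.
  rewrite expr0 mulr1 (le_trans (ler_normB _ _))// -[2]/(1 + 1) lerD//; exact: corr_le1.
by rewrite exprSr mulrA; exact: D_contraction.
Qed.

Lemma self_rate_unique x : self_rate nbr mu x = self_rate nbr nu x.
Proof. by apply: eq_bigr => y _; exact: corr_unique. Qed.

(** The law enters the linear flow only through the correlations. *)
Lemma euler_unique t s : euler nbr kappa mu t s = euler nbr kappa nu t s.
Proof. by congr flatten; apply: eq_map => p; rewrite self_rate_unique. Qed.

Let phi (la : probability (borel E) R) al s := \int[la]_v cos (al + lin s (v : E)).

(** The Gaussian factor is at most [1], so that a gap between the two characteristic
    functions can only grow along the Euler steps, up to an error of order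
    [tau ^ 3 * nrm]. As [nrm] contracts by [1 - tau^2 / 4] at each step, the errors sum
    to [16 * tau * nrm s]; after [n] steps the functional is small and its two
    characteristic functions are both close to [cos al]. *)
Let char_gap al tau n s : 0 < tau -> tau <= 1 ->
  `|phi mu al s - phi nu al s| <= 16 * tau * nrm s + 2 * nrm s * (1 - tau ^+ 2 / 4) ^+ n.
Proof.
move=> tau0 tau1.
have T0 : 0 < tau ^+ 2 by rewrite exprn_gt0.
have T1 : tau ^+ 2 <= 1 by rewrite exprn_ile1// ltW.
elim: n s => [|n ih] s.
  rewrite expr0 mulr1 (@le_trans _ _ (2 * nrm s))//; last first.
    by rewrite lerDr mulr_ge0 ?nrm_ge0// mulr_ge0// ltW.
  rewrite (_ : phi mu al s - phi nu al s = (phi mu al s - cos al) - (phi nu al s - cos al)); last by ring.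
  rewrite (le_trans (ler_normB _ _))// mulrDl mul1r lerD//; exact: char_near_one.
have [P [solP statP]] := mu_stat T0; have [Q [solQ statQ]] := nu_stat T0.
have hP := char_step nbr_finite nbr_deg kappa0 kappa_deg mu1 T0 T1 solP statP s al (ltW tau0) erefl.
have hQ := char_step nbr_finite nbr_deg kappa0 kappa_deg nu1 T0 T1 solQ statQ s al (ltW tau0) erefl.
rewrite -euler_unique in hQ.
rewrite -/(phi mu al s) -/(phi _ al _) in hP; rewrite -/(phi nu al s) -/(phi nu al _) in hQ.
have := ih (euler nbr kappa mu (tau ^+ 2) s); set s' := euler _ _ _ _ _ in hP hQ *.
have ns : nrm s' <= (1 - tau ^+ 2 / 4) * nrm s.
  by apply: (nrm_euler nbr_deg kappa0 kappa_deg mu1) => //; exact: ltW.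
set e := expR _ in hP hQ; have e0 : 0 <= e by exact: expR_ge0.
have e1 : e <= 1.
  by rewrite /e -expR0 ler_expR oppr_le0 divr_ge0// mulr_ge0 ?rate_ge0// ltW.
set r := 1 - tau ^+ 2 / 4 in ns *; set N := nrm s in hP hQ ns *.
have r0 : 0 <= r by rewrite /r; lra.
have rn : 0 <= r ^+ n by exact: exprn_ge0.
have N0 : 0 <= N := nrm_ge0 s.
set a := phi mu al s in hP *; set b := phi nu al s in hQ *.
set a' := phi mu al s' in hP *; set b' := phi nu al s' in hQ *.
move=> h.
have h2 : `|a - b| <= 4 * N * tau ^+ 3 + `|a' - b'|.
  have -> : a - b = (a - e * a') - (b - e * b') + e * (a' - b') by ring.
  rewrite (le_trans (ler_normD _ _))// lerD//; last first.
    by rewrite normrM (ger0_norm e0) ler_piMl.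
  by rewrite (le_trans (ler_normB _ _))//; lra.
apply: (le_trans h2).
have h3 : 16 * tau * nrm s' + 2 * nrm s' * r ^+ n <= (16 * tau + 2 * r ^+ n) * (r * N).
  rewrite (_ : _ + _ = (16 * tau + 2 * r ^+ n) * nrm s'); last by ring.
  by rewrite ler_wpM2l// addr_ge0// mulr_ge0// ltW.
have E3 : (16 * tau + 2 * r ^+ n) * (r * N) = 16 * tau * N - 4 * N * tau ^+ 3 + 2 * N * r ^+ n.+1.
  by rewrite (exprS r n); generalize (r ^+ n) => z; rewrite /r; field.
lra.
Qed.

Lemma char_unique al s :
  \int[mu]_v cos (al + lin s (v : E)) = \int[nu]_v cos (al + lin s (v : E)).
Proof.
apply/eqP; rewrite -subr_eq0; apply/eqP.
apply: (@norm_le_small _ _ (16 * nrm s)) => tau tau0 tau1.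
have r1 : `|1 - tau ^+ 2 / 4| < 1.
  have T0 : 0 < tau ^+ 2 by rewrite exprn_gt0.
  have T1 : tau ^+ 2 <= 1 by rewrite exprn_ile1// ltW.
  by rewrite ger0_norm; lra.
have c1 : 16 * tau * nrm s + 2 * nrm s * (1 - tau ^+ 2 / 4) ^+ n @[n --> \oo] -->
   16 * tau * nrm s + 2 * nrm s * 0.
  by apply: cvgD; [exact: cvg_cst|apply: cvgMr; exact: cvg_expr].
rewrite mulr0 addr0 mulrAC in c1.
by apply: (cvgr_to_ge c1); apply: nearW => n; have := char_gap al n s tau0 tau1; rewrite mulrAC.
Qed.

End uniqueness.

(** * Characteristic functions determine the law *)

Section trigonometric_class.
Context (R : realType) (I : choiceType) (c : I -> {posnum R}).
Local Notation E := (ell2 c).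
Implicit Types (f g : E -> R) (s : seq (R * I)).

(** The bounded pointwise closure of trigonometric polynomials. Being closed under
    products, it contains the indicators of a sigma-algebra; two laws with the same
    characteristic function integrate its members alike. *)
Inductive trig_class : (E -> R) -> Prop :=
| Trig_cos al s : trig_class (fun v => cos (al + lin s v))
| Trig_linear a f g : trig_class f -> trig_class g -> trig_class (fun v => a * f v + g v)
| Trig_limit (f_ : nat -> E -> R) f B :
    (forall n, trig_class (f_ n)) -> (forall n v, `|f_ n v| <= B) ->
    (forall v, f_ n v @[n --> \oo] --> f v) -> trig_class f.

Lemma trig_ext f g : f =1 g -> trig_class f -> trig_class g.
Proof. by move=> /funext ->. Qed.

Lemma trig_cst a : trig_class (fun=> a).
Proof.
have h1 : trig_class (fun=> 1).
  apply: trig_ext (Trig_cos 0 [::]) => v.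
  by rewrite /lin big_nil addr0 cos0.
have h0 := Trig_linear (-1) h1 h1.
by apply: trig_ext (Trig_linear a h1 h0) => v; ring.
Qed.

Lemma trigZ a f : trig_class f -> trig_class (fun v => a * f v).
Proof.
by move=> tf; apply: trig_ext (Trig_linear a tf (trig_cst 0)) => v; rewrite addr0.
Qed.

Lemma trigD f g : trig_class f -> trig_class g -> trig_class (fun v => f v + g v).
Proof.
by move=> tf tg; apply: trig_ext (Trig_linear 1 tf tg) => v; rewrite mul1r.
Qed.

Lemma trigB f g : trig_class f -> trig_class g -> trig_class (fun v => f v - g v).
Proof.
by move=> tf tg; apply: trig_ext (Trig_linear (-1) tg tf) => v; ring.
Qed.

Lemma trig_bounded f : trig_class f -> exists B, forall v, `|f v| <= B.
Proof.
elim=> [al s|a {}f g _ [B fB] _ [C gC]|f_ {}f B _ _ fB cf].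
- by exists 1 => v; rewrite ler_norml cos_le1 cos_geN1.
- exists (`|a| * B + C) => v; rewrite (le_trans (ler_normD _ _))// lerD//.
  by rewrite normrM ler_wpM2l.
- exists B => v; have h : `|f_ n v| @[n --> \oo] --> `|f v| by apply: cvg_norm; exact: cf.
  by apply: (cvgr_to_le h); exact: nearW.
Qed.

(** First products with a single cosine, then in [trigM] arbitrary products: each
    induction runs over one factor with the other fixed. *)
Lemma trig_cosM al s f : trig_class f -> trig_class (fun v => cos (al + lin s v) * f v).
Proof.
elim=> [be s'|a {}f g _ hf _ hg|f_ {}f B tf hf fB cf].
- have h1 := Trig_cos (al + be) (s ++ s').
  have h2 := Trig_cos (al - be) (s ++ scale (-1) s').
  apply: trig_ext (trigZ 2^-1 (trigD h1 h2)) => v.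
  rewrite !lin_cat lin_scale.
  have -> : al + be + (lin s v + lin s' v) = (al + lin s v) + (be + lin s' v) by ring.
  have -> : al - be + (lin s v + -1 * lin s' v) = (al + lin s v) - (be + lin s' v) by ring.
  by rewrite cosD cosB; field.
- by apply: trig_ext (Trig_linear a hf hg) => v; ring.
- apply: (@Trig_limit (fun n v => cos (al + lin s v) * f_ n v) _ B) => //.
    move=> n v; rewrite normrM -[leRHS]mul1r ler_pM// ler_norml.
    by rewrite cos_le1 cos_geN1.
  by move=> v; apply: cvgMr; exact: cf.
Qed.

Lemma trigM f g : trig_class f -> trig_class g -> trig_class (fun v => f v * g v).
Proof.
move=> tf tg; elim: tf => [al s|a {}f h _ hf _ hh|f_ {}f B tf hf fB cf].
- exact: trig_cosM.
- by apply: trig_ext (Trig_linear a hf hh) => v; ring.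
- have [C gC] := trig_bounded tg.
  apply: (@Trig_limit (fun n v => f_ n v * g v) _ (B * C)) => //.
    by move=> n v; rewrite normrM ler_pM.
  by move=> v; apply: cvgMl; exact: cf.
Qed.

Lemma trigX f n : trig_class f -> trig_class (fun v => f v ^+ n).
Proof.
move=> tf; elim: n => [|n ih].
  by apply: trig_ext (trig_cst 1) => v; rewrite expr0.
by apply: trig_ext (trigM tf ih) => v; rewrite exprS.
Qed.

(** The absolute value is reached from within the polynomials in [f] by the
    monotone iteration [p -> p + (f^2 - p^2) / 2]. *)
Lemma trig_norm f : trig_class f -> (forall v, `|f v| <= 1) ->
  trig_class (fun v => `|f v|).
Proof.
move=> tf f1.
pose step (p : E -> R) v := p v + (f v ^+ 2 - p v ^+ 2) / 2.
pose p n := iter n step (fun=> 0).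
have pS n v : p n.+1 v = p n v + (f v ^+ 2 - p n v ^+ 2) / 2 by [].
have p_range n v : 0 <= p n v <= `|f v|.
  elim: n => [|n /andP[ih1 ih2]]; first by rewrite /p /= lexx normr_ge0.
  rewrite pS -(real_normK (num_real (f v))).
  by have := f1 v; set x := `|f v| in ih2 *; set y := p n v in ih1 ih2 * => ?; apply/andP; split; nra.
apply: (@Trig_limit p _ 1).
- elim=> [|n ih]; first exact: trig_cst.
  apply: trig_ext (trigD ih (trigZ 2^-1 (trigB (trigX 2 tf) (trigX 2 ih)))) => v.
  by rewrite pS; ring.
- by move=> n v; have /andP[h1 h2] := p_range n v; rewrite ger0_norm// (le_trans h2).
- move=> v; have gap n : `|f v| - p n v <= (1 - `|f v| / 2) ^+ n.
    elim: n => [|n ih]; first by rewrite expr0 /p /= subr0.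
    have /andP[h1 h2] := p_range n v.
    have -> : `|f v| - p n.+1 v = (`|f v| - p n v) * (1 - (`|f v| + p n v) / 2).
      by rewrite pS -(real_normK (num_real (f v))); field.
    have := f1 v; rewrite exprSr => fv1; apply: ler_pM => //; last by lra.
    - by rewrite subr_ge0.
    - by lra.
  have [f0|f0] := eqVneq (f v) 0.
    rewrite f0 normr0; apply: cvg_near_cst; apply: nearW => n.
    by have := p_range n v; rewrite f0 normr0 -eq_le => /eqP.
  have fp : 0 < `|f v| by rewrite normr_gt0.
  have c0 : (1 - `|f v| / 2) ^+ n @[n --> \oo] --> 0.
    by apply: cvg_expr; have := f1 v => ?; rewrite ltr_norml; apply/andP; split; lra.
  have c1 : `|f v| - (1 - `|f v| / 2) ^+ n @[n --> \oo] --> `|f v|.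
    by rewrite -[X in _ --> X]subr0; apply: cvgB => //; exact: cvg_cst.
  apply: (squeeze_cvgr _ c1 (cvg_cst _)); apply: nearW => n.
  by have /andP[h1 h2] := p_range n v; rewrite h2 andbT; have := gap n; lra.
Qed.

(** [1 - (1 - f)^n] increases to the indicator of positivity. *)
Lemma trig_positive f : trig_class f -> (forall v, 0 <= f v <= 1) ->
  trig_class (\1_[set v | 0 < f v]).
Proof.
move=> tf f01; apply: (@Trig_limit (fun n v => 1 - (1 - f v) ^+ n) _ 1).
- by move=> n; apply: trigB; [exact: trig_cst|apply/trigX/trigB => //; exact: trig_cst].
- move=> n v; have /andP[f0 f1] := f01 v.
  have h0 : 0 <= (1 - f v) ^+ n by rewrite exprn_ge0// subr_ge0.
  have h1 : (1 - f v) ^+ n <= 1 by rewrite exprn_ile1 ?subr_ge0// lerBlDr lerDl.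
  by rewrite ger0_norm; lra.
- move=> v; rewrite indicE; have /andP[f0 f1] := f01 v.
  move: f0; rewrite le_eqVlt => /predU1P[f0|f0].
    rewrite memNset/=; last by rewrite -f0 ltxx.
    apply: cvg_near_cst; apply: nearW => n.
    by rewrite -f0 subr0 expr1n subrr.
  rewrite mem_set//= -[X in _ --> X]subr0; apply: cvgB; first exact: cvg_cst.
  by apply: cvg_expr; rewrite ger0_norm; lra.
Qed.

(** The sign of [sin ((v x - t) / n)] is eventually that of [v x - t]. *)
Lemma trig_half_space x (t : R) : trig_class (\1_[set v : E | t < v x]).
Proof.
pose y n (v : E) := (v x - t) / n.+1%:R.
have ts n : trig_class (fun v => sin (y n v)).
  apply: trig_ext (Trig_cos (- t / n.+1%:R - pi / 2) [:: (n.+1%:R^-1, x)]) => v.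
  rewrite -cosBpihalf /lin big_cons big_nil /= /y; congr cos; ring.
have s1 n v : `|sin (y n v)| <= 1 by rewrite ler_norml sin_le1 sin_geN1.
pose g n := \1_[set v : E | 0 < sin (y n v)] : E -> R.
have tg n : trig_class (g n).
  have tp := trigZ 2^-1 (trigD (trig_norm (ts n) (s1 n)) (ts n)).
  rewrite /g (_ : [set v : E | 0 < sin (y n v)] =
      [set v | 0 < 2^-1 * (`|sin (y n v)| + sin (y n v))]).
    apply: trig_positive => // v; have := s1 n v; have := ler_norm (- sin (y n v)).
    by have := ler_norm (sin (y n v)); rewrite normrN => ? ? ?; apply/andP; split; lra.
  apply/seteqP; split => v /=; first by move=> h; rewrite gtr0_norm//; lra.
  have [h|h] := leP 0 (sin (y n v)); first by rewrite ger0_norm//; lra.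
  by rewrite ltr0_norm//; lra.
apply: (@Trig_limit g _ 1) => //.
  by move=> n v; rewrite /g indicE; case: (_ \in _); rewrite ?normr1 ?normr0.
move=> v; apply: cvg_near_cst.
have p2 : 0 < pi / 2 :> R by rewrite divr_gt0// pi_gt0.
have d0 : 0 < (pi / 2) / (`|v x - t| + 1) by rewrite divr_gt0// ltr_wpDl.
have [n0 _ Hn] := @near_infty_natSinv_lt R (PosNum d0).
exists n0 => // n /Hn /= nd; rewrite /g !indicE; congr (_%:R); congr nat_of_bool.
have yb : `|y n v| < pi / 2.
  rewrite /y normrM (ger0_norm (x := _^-1))//.
  rewrite ltr_pdivlMr ?ltr_wpDl// in nd; apply: le_lt_trans nd.
  by rewrite mulrC ler_wpM2l// lerDl.
apply/idP/idP => /set_mem /= h; apply/mem_set => /=.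
  rewrite -subr_gt0 ltNge; apply/negP => h'.
  have y0 : y n v <= 0 by rewrite /y pmulr_lle0// invr_gt0.
  move: h; rewrite ltNge => /negP; apply.
  move: y0; rewrite le_eqVlt => /predU1P[->|y0]; first by rewrite sin0.
  rewrite -oppr_ge0 -sinN ltW// sin_gt0_pihalf// oppr_gt0 y0/=.
  by rewrite -ltr0_norm.
apply: sin_gt0_pihalf.
have y0 : 0 < y n v by rewrite divr_gt0// subr_gt0.
by rewrite y0 -(gtr0_norm y0).
Qed.

(** Complements are differences, intersections are products, and a countable union is
    the complement of a decreasing limit of finite intersections. *)
Lemma trig_sigma_algebra : sigma_algebra [set: E] [set A | trig_class (\1_A)].
Proof.
have tC A : trig_class (\1_A) -> trig_class (\1_(~` A)).
  move=> tA; apply: trig_ext (trigB (trig_cst 1) tA) => v.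
  by rewrite !indicE in_setC; case: (v \in A); rewrite ?subrr ?subr0.
have tI A B : trig_class (\1_A) -> trig_class (\1_B) -> trig_class (\1_(A `&` B)).
  move=> tA tB; apply: trig_ext (trigM tA tB) => v.
  by rewrite !indicE in_setI; case: (v \in A); case: (v \in B); rewrite ?mulr1 ?mulr0 ?mul0r.
split.
- by apply: trig_ext (trig_cst 0) => v; rewrite indicE in_set0.
- by move=> A tA; rewrite setTD; exact: tC.
move=> A tA.
pose B n := \big[setI/setT]_(k < n) ~` A k.
have tB n : trig_class (\1_(B n)).
  elim: n => [|n ih]; rewrite /B.
    by rewrite big_ord0; apply: trig_ext (trig_cst 1) => v; rewrite indicE in_setT.
  by rewrite big_ord_recr/=; apply: tI => //; apply: tC; exact: tA.
have BP n v : B n v <-> forall k, (k < n)%N -> ~ A k v.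
  elim: n => [|n ih]; first by rewrite /B big_ord0.
  rewrite /B big_ord_recr/= -/(B n); split.
    move=> [/ih h nA] k; rewrite ltnS leq_eqVlt => /predU1P[->//|]; exact: h.
  move=> h; split; last exact: h.
  by apply/ih => k kn; apply: h; exact: ltnW.
rewrite -[\bigcup_k A k]setCK; apply: tC.
apply: (@Trig_limit (fun n => \1_(B n)) _ 1) => //.
  by move=> n v; rewrite indicE; case: (_ \in _); rewrite ?normr1 ?normr0.
move=> v; apply: cvg_near_cst; have [[k _ Ak]|nA] := pselect ((\bigcup_k A k) v).
  exists k.+1 => // n /= kn; rewrite !indicE memNset; last by move=> /BP/(_ k kn).
  by rewrite memNset//= => /(_ _); apply; exists k.
apply: nearW => n; rewrite !indicE mem_set; last first.
  by apply/BP => k _ Ak; apply: nA; exists k.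
by rewrite mem_set.
Qed.

Variables mu nu : probability (borel E) R.
Hypothesis char_eq : forall al s,
  \int[mu]_v cos (al + lin s (v : E)) = \int[nu]_v cos (al + lin s (v : E)).

Lemma trig_measurable f : trig_class f -> measurable_fun [set: borel E] (f : borel E -> R).
Proof.
elim=> [al s|a {}f g _ hf _ hg|f_ {}f B _ hf fB cf].
- apply: (@measurableT_comp _ _ _ _ _ _ (@cos R)).
    by apply: continuous_measurable_fun; exact: continuous_cos.
  by apply: measurable_funD => //; exact: measurable_lin.
- by apply: measurable_funD => //; exact: measurable_funM.
- by apply: (@measurable_fun_cvg _ (borel E) R setT f_) => // v _; exact: cf.
Qed.

Lemma trig_same_integral f : trig_class f -> \int[mu]_v f v = \int[nu]_v f v.
Proof.
have iT (la : probability (borel E) R) g : trig_class g ->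
    la.-integrable [set: borel E] (EFin \o (g : borel E -> R)).
  move=> tg; have [B gB] := trig_bounded tg.
  exact: (@intg_bounded _ _ _ la _ B (trig_measurable tg) gB).
elim=> [al s|a {}f g tf hf tg hg|f_ {}f B tf hf fB cf].
- exact: char_eq.
- rewrite EXD; [|by apply: intgZ; exact: iT|exact: iT].
  rewrite EXD; [|by apply: intgZ; exact: iT|exact: iT].
  by rewrite !EXZ ?hf ?hg//; exact: iT.
- have tl : trig_class f by exact: (@Trig_limit f_ _ B).
  have cv (la : probability (borel E) R) : \int[la]_v f_ n v @[n --> \oo] --> \int[la]_v f v.
    apply: (@dct_cvg _ _ _ la f_ f (fun=> B)) => //.
    + by move=> n; exact: trig_measurable.
    + exact: trig_measurable.
    + exact: intg_cst.
    + by apply: aeW => v; exact: cf.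
  have := cv mu; under eq_fun do rewrite hf.
  by move=> h; exact: (cvg_unique (@Rhausdorff R) h (cv nu)).
Qed.

End trigonometric_class.

(** * Coordinates generate the Borel sets *)

Section borel_sets.
Context (R : realType) (I : countType) (c : I -> {posnum R}).
Local Notation E := (ell2 c).

Definition half_spaces : set (set E) :=
  [set A | exists x t, A = [set v : E | t < v x]].

Let S := g_sigma_algebraType half_spaces.

Let measurable_coord_half x : measurable_fun [set: S] (fun v : S => (v : E) x).
Proof.
apply: (measurability _ (RGenOInfty.measurableE R)).
move=> _ [_ [a ->] <-]; rewrite setTI; apply: sub_sigma_algebra.
by exists x, a; apply/seteqP; split => v /=; rewrite in_itv/= andbT.
Qed.

(** The weighted norm is the supremum of its finite partial sums, and there are
    countably many lists of sites. *)
Let closed_ball_sums (p : E) (r : R) : 0 <= r ->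
  [set v : E | `|v - p| <= r] = \bigcap_(s : seq I)
    [set v : E | uniq s -> \sum_(x <- s) (c x)%:num * (v x - p x) ^+ 2 <= r ^+ 2].
Proof.
move=> r0; have sE (v : E) s : uniq s -> (\sum_(x <- s) (c x)%:num * (v x - p x) ^+ 2)%:E =
    (\sum_(x \in [set` s]) ((c x)%:num * ((v - p)%R : E) x ^+ 2)%:E)%E.
  by move=> us; rewrite -fsbig_seq// sumEFin.
have nE (v : E) : (`|v - p| <= r) = (enorm2 c (v - p)%R <= (r ^+ 2)%:E)%E.
  by rewrite -(ell2_norm_sqr (v - p)) lee_fin ler_sqr ?nnegrE// ell2_norm_ge0.
apply/seteqP; split => v /=; rewrite nE => h.
  move=> s _ us; rewrite -lee_fin sE//; apply: le_trans h.
  by apply: ereal_sup_ubound; exists [set` s] => //; split => //; exact: finite_seq.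
apply: ge_ereal_sup => _ [X [finX _] <-].
have := h (finmap.enum_fset (fset_set X)) Logic.I (finmap.fset_uniq _).
have Xr : X = [set` finmap.enum_fset (fset_set X)] by rewrite -[LHS](fset_setK finX).
by rewrite -lee_fin sE ?finmap.fset_uniq// -Xr.
Qed.

Let measurable_closed_ball (p : E) r : 0 <= r ->
  measurable ([set v : E | `|v - p| <= r] : set S).
Proof.
move=> r0; rewrite closed_ball_sums//.
rewrite -[X in measurable X]setCK; apply: measurableC; rewrite setC_bigcap.
apply: countable_bigcupT_measurable => [|s]; first exact: countableP.
apply: measurableC; have [us|nus] := boolP (uniq s); last first.
  rewrite (_ : [set _ | _] = setT); first exact: measurableT.
  by apply/seteqP; split.
rewrite [X in measurable X](_ : _ =
   (fun v : S => \sum_(x <- s) (c x)%:num * ((v : E) x - p x) ^+ 2) @^-1` `]-oo, r ^+ 2]); last first.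
  by apply/seteqP; split => v /=; rewrite in_itv//= => /(_ isT).
have mS : measurable_fun [set: S] (fun v : S => \sum_(x <- s) (c x)%:num * ((v : E) x - p x) ^+ 2).
  apply: measurable_sum => x; apply: measurable_funM => //; apply: measurable_funX.
  by apply: measurable_funB => //; exact: measurable_coord_half.
by rewrite -[X in measurable X]setTI; exact: mS.
Qed.

Let rat_list (l : seq (rat * I)) : seq (R * I) := [seq (ratr p.1, p.2) | p <- l].

Let rat_coeff_finite l : coeff (rat_list l) \in finite_norm2 c.
Proof.
apply/asboolP; rewrite /enorm2.
have fS := coeff_finite (rat_list l); set A := [set x | _] in fS.
rewrite (esumID A)//; last by move=> x _; exact: enorm2_term_ge0.
rewrite setTI [X in (_ + X)%E]esum1 ?adde0; last first.
  by move=> x [_ /= /negP]; rewrite negbK => /eqP ->; rewrite expr0n mulr0.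
rewrite esum_fset//; last by move=> x _; exact: enorm2_term_ge0.
by rewrite fsbig_finite// sumEFin ltry.
Qed.

Let rat_point l : E := Ell2 (rat_coeff_finite l).

(** Cut the configuration off outside a finite set that carries all but [e^2 / 2] of the
    squared norm, and round it to rationals inside. *)
Let rat_dense (v : E) (e : R) : 0 < e -> exists l, `|v - rat_point l| <= e.
Proof.
move=> e0.
have vfin := ell2_fin v; have e20 : 0 < e ^+ 2 / 2 by rewrite divr_gt0// exprn_gt0.
have [_ [X [finX _] <-] hX] := ub_ereal_sup_adherent e20 vfin.
pose r := finmap.enum_fset (fset_set X).
have ur : uniq r by exact: finmap.fset_uniq.
have Xr : X = [set` r] by rewrite -[LHS](fset_setK finX).
pose C := \sum_(x <- r) (c x)%:num.
have C0 : 0 <= C by exact: sumr_ge0.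
pose eta := Num.sqrt (e ^+ 2 / 2 / (C + 1)).
have C1 : 0 < C + 1 by rewrite ltr_wpDl.
have eta0 : 0 < eta by rewrite sqrtr_gt0 divr_gt0.
have qP x : exists q : rat, `|v x - ratr q| <= eta.
  have /rat_in_itvoo[q] : v x < v x + eta by rewrite ltrDl.
  rewrite in_itv/= => /andP[h1 h2]; exists q.
  by rewrite distrC ger0_norm ?subr_ge0 ?(ltW h1)// lerBlDl ltW.
have [q hq] := choice qP.
exists [seq (q x, x) | x <- r]; set p := rat_point _.
have pE x : p x = if x \in r then ratr (q x) else 0.
  rewrite /p /rat_point /= /coeff /rat_list !big_map /=.
  case: ifPn => xr; last first.
    by rewrite big_seq_cond big1// => y /andP[yr /eqP yx]; move: xr; rewrite -yx yr.
  rewrite big_mkcond (bigD1_seq x)//= eqxx big1 ?addr0//.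
  by move=> y /negPf ->.
suff : (enorm2 c (v - p)%R <= (e ^+ 2)%:E)%E.
  by rewrite -(ell2_norm_sqr (v - p)) lee_fin ler_sqr ?nnegrE ?ell2_norm_ge0// ltW.
rewrite /enorm2 (esumID X)//; last by move=> x _; exact: enorm2_term_ge0.
rewrite setTI.
have tail : (\esum_(x in [set: I] `&` ~` X) ((c x)%:num * ((v - p)%R : E) x ^+ 2)%:E <=
    (e ^+ 2 / 2)%:E)%E.
  have -> : \esum_(x in [set: I] `&` ~` X) ((c x)%:num * ((v - p)%R : E) x ^+ 2)%:E =
      \esum_(x in [set: I] `&` ~` X) ((c x)%:num * v x ^+ 2)%:E.
    apply: eq_esum => x [_]; rewrite Xr /= => /negP xr.
    congr ((_ * _ ^+ 2)%:E); rewrite -[LHS]/(v x - p x).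
    by rewrite pE (negPf xr) subr0.
  have hX' : (enorm2 c v - (e ^+ 2 / 2)%:E <
      \sum_(x \in X) ((c x)%:num * v x ^+ 2)%:E)%E := hX.
  move: vfin hX'; rewrite /enorm2.
  rewrite (esumID X)//; last by move=> x _; exact: enorm2_term_ge0.
  rewrite setTI esum_fset//; last by move=> x _; exact: enorm2_term_ge0.
  rewrite fin_numD => /andP[f1 f2].
  rewrite -(fineK f1) -(fineK f2) -EFinD lte_fin lee_fin; lra.
have head : (\esum_(x in X) ((c x)%:num * ((v - p)%R : E) x ^+ 2)%:E <= (e ^+ 2 / 2)%:E)%E.
  rewrite esum_fset//; last by move=> x _; exact: enorm2_term_ge0.
  rewrite Xr -fsbig_seq// sumEFin lee_fin.
  have K0 : 0 <= e ^+ 2 / 2 / (C + 1) by apply/ltW/divr_gt0.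
  apply: (@le_trans _ _ (\sum_(x <- r) (c x)%:num * (e ^+ 2 / 2 / (C + 1)))).
    rewrite big_seq [leRHS]big_seq; apply: ler_sum => x xr; rewrite ler_wpM2l//.
    rewrite [X in X ^+ 2 <= _](_ : _ = v x - p x)//.
    rewrite pE xr -(sqr_sqrtr K0) -/eta.
    by rewrite -(real_normK (num_real (_ - _))) lerXn2r// nnegrE ltW.
  have -> : \sum_(x <- r) (c x)%:num * (e ^+ 2 / 2 / (C + 1)) = C * (e ^+ 2 / 2 / (C + 1)).
    by rewrite /C mulr_suml.
  rewrite mulrCA ler_piMr ?(ltW e20)// ler_pdivrMr// mul1r.
  by rewrite lerDl.
apply: (le_trans (leeD head tail)); rewrite -EFinD lee_fin; lra.
Qed.

(** Open sets are countable unions of closed balls around finitely supported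
    rational points, and the norm is a countable supremum of functions of
    finitely many coordinates. *)
Lemma borel_half_spaces (U : set E) : open U -> <<s half_spaces >> U.
Proof.
move=> oU.
pose B (z : seq (rat * I) * nat) : set E :=
  [set v : E | `|v - rat_point z.1| <= z.2.+1%:R^-1 /\
     [set u : E | `|u - rat_point z.1| <= z.2.+1%:R^-1] `<=` U].
have -> : U = \bigcup_z B z.
  apply/seteqP; split => v; last by move=> [z _ [h1]]; exact.
  move=> Uv; have /nbhs_ballP[d /= d0 dU] : nbhs v U by exact: open_nbhs_nbhs.
  have d20 : 0 < d / 2 by rewrite divr_gt0.
  have [n _ Hn] := @near_infty_natSinv_lt R (PosNum d20).
  have {}Hn := Hn n (leqnn n); rewrite /= in Hn.
  have [l hl] := @rat_dense v n.+1%:R^-1 ltac:(by rewrite invr_gt0).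
  exists (l, n) => //; split => //= u /= hu; apply: dU; rewrite -ball_normE /=.
  have -> : v - u = (v - rat_point l) - (u - rat_point l) by rewrite opprB addrA subrK.
  rewrite (le_lt_trans (ler_normB _ _))// (le_lt_trans (lerD hl hu))//=.
  by rewrite [ltRHS]splitr ltrD.
apply: (@countable_bigcupT_measurable _ S) => [|z]; first exact: countableP.
have [h|h] := pselect ([set u : E | `|u - rat_point z.1| <= z.2.+1%:R^-1] `<=` U).
  rewrite (_ : B z = [set v : E | `|v - rat_point z.1| <= z.2.+1%:R^-1]).
    by apply: measurable_closed_ball; rewrite invr_ge0.
  by apply/seteqP; split => [v []//|v hv]; split.
rewrite (_ : B z = set0); first exact: (@measurable0 _ S).
by apply/seteqP; split => // v [_ /h].
Qed.

Lemma char_same_law (mu nu : probability (borel E) R) :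
  (forall al s, \int[mu]_v cos (al + lin s (v : E)) = \int[nu]_v cos (al + lin s (v : E))) ->
  same_law mu nu.
Proof.
move=> char_eq A mA.
have tA : trig_class (\1_A : E -> R).
  apply: (smallest_sub (@trig_sigma_algebra R I c) _ mA).
  move=> U /borel_half_spaces; apply: (smallest_sub (@trig_sigma_algebra R I c)).
  by move=> _ [x [t ->]]; exact: trig_half_space.
have := trig_same_integral char_eq tA; rewrite !EX_indic//.
by move=> h; have := congr1 EFin h; rewrite !fineK ?fin_num_measure.
Qed.

End borel_sets.

(** * Stationary laws on the lattices *)

Lemma stationary_unique (R : realType) (I : countType) (c : I -> {posnum R})
    (nbr : rel I) (kappa deg : R) :
  (forall x, finite_set [set y | nbr x y]) ->
  (forall x, (size (nbs nbr x))%:R <= deg) ->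
  0 <= kappa -> kappa * deg <= 1 / 16 ->
  forall mu nu : probability (borel (ell2 c)) R, in_P1 mu -> in_P1 nu ->
  stationary nbr kappa mu -> stationary nbr kappa nu -> same_law mu nu.
Proof.
move=> nf nd k0 kd mu nu mu1 nu1 smu snu; apply: char_same_law => al s.
exact: (char_unique nf nd k0 kd mu1 nu1 smu snu).
Qed.

(** Each direction has one successor and one predecessor, which may coincide on small
    tori. *)
Lemma neighbor_degree d (J : choiceType) (succ pred : J -> J) (x : {ffun 'I_d -> J}) :
  cancel succ pred -> (size (nbs (neighbor succ) x) <= 2 * d)%N.
Proof.
move=> succK.
pose upd (h : J -> J) i : {ffun 'I_d -> J} := [ffun j => if j == i then h (x j) else x j].
pose r := [seq upd succ i | i <- enum 'I_d] ++ [seq upd pred i | i <- enum 'I_d].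
have -> : (2 * d = size r)%N.
  by rewrite size_cat !size_map -enumT size_enum_ord mul2n addnn.
apply: uniq_leq_size => [|y]; first exact: finmap.fset_uniq.
rewrite in_fset_set ?inE; last exact: finite_neighbor succK.
move=> /andP[_ /orP[] /existsP[i /andP[/eqP yi /forallP yj]]].
  rewrite mem_cat; apply/orP; left; apply/mapP; exists i; first by rewrite mem_enum.
  apply/ffunP => j; rewrite ffunE; case: eqVneq => [->//|ji].
  exact/eqP/(implyP (yj j)).
rewrite mem_cat; apply/orP; right; apply/mapP; exists i; first by rewrite mem_enum.
apply/ffunP => j; rewrite ffunE; case: eqVneq => [->|ji]; first by rewrite yi succK.
exact/esym/eqP/(implyP (yj j)).
Qed.

Theorem theorem1p8 (R : realType) (d L : nat) (hd : (1 <= d)%N) (hL : (1 <= L)%N)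
    (a : R) (ha : 1 < a) (kappa : R) (hkappa0 : 0 < kappa)
    (hkappa : kappa < 1 / (32 * d%:R)) :
  (forall mu nu : probability (borel (ell2 (@unit_weight R (torus d L)))) R,
     in_P1 mu -> in_P1 nu ->
     stationary (@torus_neighbor d L) kappa mu ->
     stationary (@torus_neighbor d L) kappa nu ->
     same_law mu nu) /\
  (forall mu nu : probability (borel (ell2 (@Zd_weight R a ha d))) R,
     in_P1 mu -> in_P1 nu ->
     stationary (@Zd_neighbor d) kappa mu ->
     stationary (@Zd_neighbor d) kappa nu ->
     same_law mu nu).
Proof.
have kd : kappa * (2 * d)%:R <= 1 / 16.
  have d0 : (0 : R) < d%:R by rewrite ltr0n.
  have : kappa * (32 * d%:R) <= 1 by rewrite -ler_pdivlMr ?ltW// mulr_gt0.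
  by rewrite natrM; lra.
split.
- apply: (@stationary_unique R (torus d L) _ _ kappa (2 * d)%:R) => //.
  + by move=> x; exact: finite_finset.
  + by move=> x; rewrite ler_nat; apply: neighbor_degree; exact: ordSK.
  + exact: ltW.
- apply: (@stationary_unique R ({ffun 'I_d -> int} : countType) _ _ kappa (2 * d)%:R) => //.
  + exact: Zd_neighbor_finite.
  + move=> x; rewrite ler_nat; apply: (@neighbor_degree _ _ _ (fun k => k - 1)) => k.
    by rewrite addrK.
  + exact: ltW.
Qed.
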